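(* For every integer $r>1$ there exist a normal affine algebraic variety $X^r$ of dimension $r$, an affine algebraic variety $Y^r$ that is not normal, and an algebraic bi-Lipschitz homeomorphism $\phi: X^r\to Y^r$.
   Context: Varieties are over $\mathbb{C}$. Affine algebraic varieties are closed algebraic subsets of some $\mathbb{C}^n$, equipped with the metric induced by the norm of the ambient space. A continuous mapping between affine varieties $X\subset\mathbb{C}^n$, $Y\subset\mathbb{C}^m$ is called algebraic if its graph in $\mathbb{C}^n\times\mathbb{C}^m$ is a complex algebraic set (so it need not be a regular mapping). A homeomorphism $\phi:X\to Y$ is bi-Lipschitz if there is a constant $K>0$ with $\frac1K\|x-x'\|\le\|\phi(x)-\phi(x')\|\le K\|x-x'\|$ for all $x,x'\in X$. An algebraic bi-Lipschitz homeomorphism is a homeomorphism that is both algebraic and bi-Lipschitz. *)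

(* Defs.v *)
From HB Require Import structures.
From mathcomp Require Import all_boot all_order all_algebra.
From mathcomp Require Import ring_quotient fraction mxpoly complex mpoly.
From mathcomp Require Import boolp classical_sets functions reals topology.
From mathcomp Require Import normedtype.

Set Implicit Arguments.
Unset Strict Implicit.
Unset Printing Implicit Defensive.

Import Order.TTheory GRing.Theory Num.Theory.
Import numFieldNormedType.Exports.

Local Open Scope classical_set_scope.
Local Open Scope ring_scope.

Section IntegrallyClosed.
Variable A : comNzRingType.

(* A itself, once its nonzero elements are known to be regular; the inverse is
   a classical choice, needed because idomainType extends unitRingType. *)
Definition domain_of (domA : GRing.integral_domain_axiom A) : Type := A.

Variable domA : GRing.integral_domain_axiom A.
Local Notation D := (domain_of domA).

HB.instance Definition _ := GRing.ComNzRing.on D.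

Definition domain_unit (x : D) : bool := `[< exists y : D, y * x = 1 >].
Definition domain_inv (x : D) : D :=
  if pselect (exists y : D, y * x = 1) is left ex then projT1 (cid ex) else x.

Lemma domain_mulVx : {in domain_unit, left_inverse 1 domain_inv *%R}.
Proof.
move=> x; rewrite unfold_in => /asboolP ux.
by rewrite /domain_inv; case: pselect => // ex; case: (cid ex).
Qed.

Lemma domain_unitPl (x y : D) : y * x = 1 -> domain_unit x.
Proof. by move=> yx1; apply/asboolP; exists y. Qed.

Lemma domain_invx_out : {in [predC domain_unit], domain_inv =1 id}.
Proof.
move=> x; rewrite inE unfold_in => /asboolPn nux.
by rewrite /domain_inv; case: pselect.
Qed.

HB.instance Definition _ := GRing.ComNzRing_hasMulInverse.Build D
  domain_mulVx domain_unitPl domain_invx_out.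
HB.instance Definition _ := GRing.ComUnitRing_isIntegral.Build D domA.

End IntegrallyClosed.

Definition integrally_closed_domain (A : comNzRingType) : Prop :=
  exists domA : GRing.integral_domain_axiom A,
    forall z : {fraction (domain_of domA)},
      integralOver (@FracField.tofrac (domain_of domA)) z ->
      exists a : domain_of domA, z = FracField.tofrac a.

Section AffineVarieties.
Variable R : realType.
Local Notation C := R[i].

Section Zariski.
Variable n : nat.
Implicit Types (X Z : set 'rV[C]_n) (x : 'rV[C]_n) (p : {mpoly C[n]}).

Definition algebraic_set X : Prop :=
  exists S : set {mpoly C[n]}, X = [set x | forall p, S p -> p.@[x 0] = 0].

Definition vanishing_on X p : Prop := forall x, X x -> p.@[x 0] = 0.

Definition irreducible_set Z : Prop :=
  Z !=set0 /\
  forall A B : set 'rV[C]_n, algebraic_set A -> algebraic_set B ->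
    Z `<=` A `|` B -> Z `<=` A \/ Z `<=` B.

(* A strictly increasing chain F_0, ..., F_d of irreducible closed subsets. *)
Definition irreducible_chain X (d : nat) (F : nat -> set 'rV[C]_n) : Prop :=
  (forall i, (i <= d)%N ->
     [/\ algebraic_set (F i), irreducible_set (F i) & F i `<=` X]) /\
  (forall i, (i < d)%N -> F i `<` F i.+1).

Definition has_dimension X (d : nat) : Prop :=
  (exists F, irreducible_chain X d F) /\
  (forall e, (exists F, irreducible_chain X e F) -> (e <= d)%N).

End Zariski.

Section LocalRing.
Variable n : nat.
Local Notation P := {mpoly C[n]}.
Local Notation "p %:F" := (@FracField.tofrac P p).

Lemma tofrac_neq0_at (x : 'rV[C]_n) (g : P) : g.@[x 0] != 0 -> g%:F != 0.
Proof.
by apply: contraNneq => /eqP; rewrite tofrac_eq0 => /eqP ->; rewrite meval0.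
Qed.

Definition regular_at (x : 'rV[C]_n) : {pred {fraction P}} := fun z =>
  `[< exists f g : P, g.@[x 0] != 0 /\ z = f%:F / g%:F >].

Lemma regular_at_subring x : GRing.subring_closed (regular_at x).
Proof.
split.
- apply/asboolP; exists 1, 1.
  by rewrite meval1 oner_neq0 tofrac1 divr1.
- move=> _ _ /asboolP[f [g [g0 ->]]] /asboolP[h [k [k0 ->]]].
  apply/asboolP; exists (f * k - h * g), (g * k).
  rewrite mevalM mulf_neq0 //; split=> //.
  by rewrite -mulNr addf_div ?(@tofrac_neq0_at x) // tofracB !tofracM mulNr.
- move=> _ _ /asboolP[f [g [g0 ->]]] /asboolP[h [k [k0 ->]]].
  apply/asboolP; exists (f * h), (g * k).
  by rewrite mevalM mulf_neq0 // mulf_div !tofracM.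
Qed.

HB.instance Definition _ x :=
  GRing.isSubringClosed.Build {fraction P} (regular_at x) (regular_at_subring x).

(* The local ring of C^n at x. *)
Definition affine_local_ring (x : 'rV[C]_n) : Type :=
  {z : {fraction P} | z \in regular_at x}.

HB.instance Definition _ x := SubChoice.on (affine_local_ring x).
HB.instance Definition _ x :=
  [SubChoice_isSubComNzRing of affine_local_ring x by <:].

Variables (X : set 'rV[C]_n) (x : 'rV[C]_n).

(* The ideal generated by I(X) in the local ring of C^n at x. *)
Definition local_ideal (Xx : X x) : {pred affine_local_ring x} := fun z =>
  `[< exists f g : P,
        [/\ vanishing_on X f, g.@[x 0] != 0 & val z = f%:F / g%:F] >].

Lemma local_ideal_closed (Xx : X x) : idealr_closed (local_ideal Xx).
Proof.
split.
- apply/asboolP; exists 0, 1; rewrite meval1 oner_neq0 tofrac0 mul0r.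
  by split=> // y _; rewrite meval0.
- apply/asboolP => -[f [g [fX g0]]] /= /esym /(canRL (divfK (tofrac_neq0_at g0))).
  rewrite mul1r => /eqP; rewrite tofrac_eq => /eqP fg.
  by move: g0; rewrite -fg fX ?eqxx.
- move=> a u v /asboolP[f [g [fX g0 Eu]]] /asboolP[h [k [hX k0 Ev]]].
  have /asboolP[s [t [t0 Ea]]] := valP a.
  apply/asboolP; exists (s * f * k + h * (t * g)), (t * g * k); split.
  + by move=> y Xy; rewrite mevalD !mevalM fX // hX // mulr0 !mul0r addr0.
  + by rewrite !mevalM !mulf_neq0.
  + rewrite /= Ea Eu Ev mulf_div addf_div ?mulf_neq0 ?(@tofrac_neq0_at x) //.
    by rewrite tofracD !tofracM.
Qed.

HB.instance Definition _ (Xx : X x) :=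
  isIdealr.Build (affine_local_ring x) (local_ideal Xx) (local_ideal_closed Xx).

Definition local_ring (Xx : X x) : comNzRingType := {ideal_quot (local_ideal Xx)}.

End LocalRing.

Definition normal_variety n (X : set 'rV[C]_n) : Prop :=
  forall x (Xx : X x), integrally_closed_domain (local_ring Xx).

Section Maps.
Variables (n m : nat) (X : set 'rV[C]_n) (Y : set 'rV[C]_m).
Variable phi : 'rV[C]_n -> 'rV[C]_m.

Definition euclidean_norm k (x : 'rV[C]_k) : R :=
  Num.sqrt (\sum_(i < k) ComplexField.Normc.normc (x 0 i) ^+ 2).

(* R[i]^o is R[i] with its topology as a normed field. *)
Definition continuous_on k l (A : set 'rV[C]_k) (f : 'rV[C]_k -> 'rV[C]_l) :=
  {within (A : set 'rV[C^o]_k), continuous (f : 'rV[C^o]_k -> 'rV[C^o]_l)}.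

Definition homeomorphism : Prop :=
  [/\ set_fun X Y phi, continuous_on X phi &
      exists psi : 'rV[C]_m -> 'rV[C]_n,
        [/\ set_fun Y X psi, continuous_on Y psi,
            forall x, X x -> psi (phi x) = x &
            forall y, Y y -> phi (psi y) = y]].

Definition algebraic_map : Prop :=
  [/\ set_fun X Y phi, continuous_on X phi &
      algebraic_set [set row_mx x (phi x) | x in X]].

Definition bilipschitz : Prop :=
  exists2 K : R, 0 < K &
    forall x x', X x -> X x' ->
      K^-1 * euclidean_norm (x - x') <= euclidean_norm (phi x - phi x') /\
      euclidean_norm (phi x - phi x') <= K * euclidean_norm (x - x').

Definition algebraic_bilipschitz_homeomorphism : Prop :=
  [/\ homeomorphism, algebraic_map & bilipschitz].

End Maps.

End AffineVarieties.

(* Main.v *)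
(* For [r = k + 2] take [X] to be the product of [C^k] with the cone over the
   rational normal quartic, the image of
     [(s, t, u) |-> (s^4, s^3 t, s^2 t^2, s t^3, t^4, u)],
   and [Y] its image under the linear projection [phi] that forgets the middle
   coordinate, which is replaced by [0] so that [X] and [Y] lie in the same space.

   Write [(a, b, c, d, e, u)] for a point of [X] and [M] for the largest modulus of
   the coordinates [a] and [e] of two points. As [c^2 = a e], [b^2 = a c] and
   [d^2 = c e], all the quartic coordinates have modulus at most [M]. If
   [M = |a|], the identity [a (c - c') = (b + b') (b - b') - c' (a - a')] gives
   [|c - c'| <= 3 max (|a - a'|, |b - b'|)]; the other cases are symmetric. Hence
   [phi] is bi-Lipschitz.

   The coordinate ring of [X] is spanned by the monomials [s^i t^j u^m] with
   [4 | i + j]. It is the intersection of its fraction field with the polynomial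
   ring, which is integrally closed, and so it is integrally closed. On [Y] the
   function [s^2 t^2 = b^2 / a] is a square root of [a e], but it is not regular at
   the origin because no function on [Y] contains the monomial [s^2 t^2].

   A chain of [e + 1] irreducible closed subsets of the image of a polynomial map
   from [C^r] yields [e] algebraically independent polynomials in [r] variables,
   whence [e <= r] by counting monomials. *)
Require Import Defs.
From HB Require Import structures.
From mathcomp Require Import all_boot all_order all_algebra.
From mathcomp Require Import generic_quotient ring_quotient fraction mxpoly complex mpoly.
From mathcomp Require Import boolp classical_sets functions reals topology.
From mathcomp Require Import normedtype.
From mathcomp Require Import zify ring lra.

Set Implicit Arguments.
Unset Strict Implicit.
Unset Printing Implicit Defensive.

Import Order.TTheory GRing.Theory Num.Theory.
Import numFieldNormedType.Exports.
Local Open Scope classical_set_scope.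
Local Open Scope quotient_scope.
Local Open Scope ring_scope.

(** * Divisibility and supports of multivariate polynomials *)

(** If [b > a], the right side is at least [(a + 1) * (d + 1)], which exceeds the left side by one.
    It compares exponents in an identity of leading monomials. *)
Lemma leq_of_scaled (a b c d : nat) :
  (d + a * d.+1 = b * d.+1 + c)%N -> (b <= a)%N.
Proof.
move=> e; rewrite leqNgt; apply/negP => lt.
by have := leq_mul lt (leqnn d.+1); rewrite mulSn; lia.
Qed.

Section Divisibility.
Variables (n : nat) (K : fieldType).
Implicit Types (p q d w : {mpoly K[n]}) (M : pred 'X_{1..n}).

Definition mdivides q p := exists h, p = q * h.

Lemma mdividesD q p1 p2 : mdivides q p1 -> mdivides q p2 -> mdivides q (p1 + p2).
Proof. by move=> [a ->] [b ->]; exists (a + b); rewrite mulrDr. Qed.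

Lemma mdivides_sum (I : Type) (r : seq I) (P : pred I) (F : I -> {mpoly K[n]}) q :
  (forall i, P i -> mdivides q (F i)) -> mdivides q (\sum_(i <- r | P i) F i).
Proof.
move=> h; elim/big_ind: _ => //; last by move=> *; apply: mdividesD.
by exists 0; rewrite mulr0.
Qed.

(** One step of division: [w] is chosen so that [q * w] has the same leading term as [p], and the
    two cancel. *)
Lemma mlead_dec p q (w := (mleadc p / mleadc q) *: 'X_[(mlead p - mlead q)%MM]) :
  p != 0 -> q != 0 -> (mlead q <= mlead p)%MM -> p - q * w != 0 ->
  (mlead (p - q * w) < mlead p)%O.
Proof.
move=> p0 q0 le pw0.
have lcq0 : mleadc q != 0 by rewrite mleadc_eq0.
have lcp0 : mleadc p != 0 by rewrite mleadc_eq0.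
have c0 : mleadc p / mleadc q != 0 by rewrite mulf_neq0 ?invr_eq0.
have w0 : w != 0 by rewrite -msupp_eq0 msuppMCX.
have lw : mlead w = (mlead p - mlead q)%MM by rewrite mleadZ // mleadXm.
have lqw : mlead (q * w) = mlead p by rewrite mleadM // lw addmC submK.
have lcw : (q * w)@_(mlead p) = mleadc p.
  rewrite -lqw mleadM // mleadcM lw mcoeffZ mcoeffX eqxx mulr1.
  by rewrite mulrC divfK // addmC submK.
have : (mlead (p - q * w) <= mlead p)%O.
  by apply: le_trans (mleadB_le _ _) _; rewrite lqw leUx lexx.
rewrite le_eqVlt => /orP[/eqP E|//]; exfalso; move: pw0.
by rewrite -mleadc_eq0 E mcoeffB lcw subrr eqxx.
Qed.

(* The polynomial ring is completely integrally closed: comparing leading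
   monomials of [d * p ^+ k = q ^+ k * h] for large [k] shows that the leading
   monomial of [q] divides that of [p]; subtracting a multiple of [q] from [p]
   preserves the hypothesis. *)
Lemma almost_integral_divides p q d : q != 0 -> d != 0 ->
  (forall k, mdivides (q ^+ k) (d * p ^+ k)) -> mdivides q p.
Proof.
move=> q0 d0; elim/mleadrect: p => p IH dvd.
have [->|p0] := eqVneq p 0; first by exists 0; rewrite mulr0.
have le : (mlead q <= mlead p)%MM.
  apply/mnm_lepP => i.
  (* The power exceeds the exponent contributed by [d], as [leq_of_scaled] requires. *)
  have [h E] := dvd ((mlead d) i).+1.
  have h0 : h != 0.
    apply: contraTneq isT => h0; move: E; rewrite h0 mulr0 => /eqP.
    by rewrite mulf_eq0 (negbTE d0) expf_eq0 (negbTE p0) andbF.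
  have := congr1 (@mlead n K) E.
  rewrite !mleadM ?expf_neq0 // !mleadX // => /mnmP/(_ i).
  by rewrite !mnmDE !mulmnE; apply: leq_of_scaled.
pose w := (mleadc p / mleadc q) *: 'X_[(mlead p - mlead q)%MM] : {mpoly K[n]}.
suff [h E] : mdivides q (p - q * w).
  by exists (h + w); rewrite mulrDr -E subrK.
have [->|pw0] := eqVneq (p - q * w) 0; first by exists 0; rewrite mulr0.
apply: IH; first exact: mlead_dec.
(* In the binomial expansion of [(p - q * w) ^+ k], the term with [(q * w) ^+ i] needs only
   [q ^+ (k - i)] from [d * p ^+ (k - i)]. *)
move=> k; rewrite exprBn mulr_sumr; apply: mdivides_sum => i _.
have [a Ea] := dvd (k - i)%N.
rewrite mulrnAr.
have ik : (i <= k)%N by rewrite -ltnS.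
exists (a * w ^+ i * (-1) ^+ i *+ 'C(k, i)).
have -> : q ^+ k = q ^+ (k - i) * q ^+ i by rewrite -exprD subnK.
rewrite [RHS]mulrnAr -mulrnAl mulrnAl exprMn; congr (_ *+ _).
transitivity ((d * p ^+ (k - i)) * ((-1) ^+ i * (q ^+ i * w ^+ i))); first by ring.
by rewrite Ea; ring.
Qed.

(** The power [q ^+ N] is a common denominator of all powers of [p / q]: the relation expresses each
    power beyond [N] through lower ones. This reduces the claim to [almost_integral_divides]. *)
Lemma monic_relation_divides p q N (c : nat -> {mpoly K[n]}) : q != 0 ->
  p ^+ N + \sum_(i < N) c i * p ^+ i * q ^+ (N - i) = 0 -> mdivides q p.
Proof.
move=> q0 E; apply: (@almost_integral_divides p q (q ^+ N)) => //.
  by rewrite expf_neq0.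
elim/ltn_ind => k IH.
have [le|lt] := leqP k N.
  by exists (q ^+ (N - k) * p ^+ k); rewrite mulrA -exprD subnKC.
move/eqP: E; rewrite addr_eq0 => /eqP E.
have -> : p ^+ k = p ^+ (k - N) * p ^+ N by rewrite -exprD subnK // ltnW.
rewrite E mulrN mulrN -mulNr mulr_sumr mulr_sumr; apply: mdivides_sum => i _.
have iN := ltn_ord i.
have [|h Eh] := IH (k - N + i)%N; first by lia.
exists (- h * c i).
have -> : q ^+ k = q ^+ (k - N + i) * q ^+ (N - i).
  by rewrite -exprD; congr (_ ^+ _); lia.
transitivity (- ((q ^+ N * p ^+ (k - N + i)) * (c i * q ^+ (N - i)))).
  by rewrite exprD; ring.
by rewrite Eh; ring.
Qed.

(** Multiplying a relation of degree [N.+1] by [g ^+ N] turns it into a monic one for [g * p]; in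
    degree [0] it would read [g = 0]. *)
Lemma integral_relation_divides g p q N (c : nat -> {mpoly K[n]}) :
  g != 0 -> q != 0 ->
  g * p ^+ N + \sum_(i < N) c i * p ^+ i * q ^+ (N - i) = 0 ->
  mdivides q (g * p).
Proof.
move=> g0 q0; case: N => [|N] E.
  by move: E; rewrite big_ord0 addr0 expr0 mulr1 => /eqP; rewrite (negbTE g0).
apply: (@monic_relation_divides _ _ N.+1 (fun i => c i * g ^+ (N - i))) => //.
transitivity (g ^+ N * (g * p ^+ N.+1 + \sum_(i < N.+1) c i * p ^+ i * q ^+ (N.+1 - i))).
  rewrite mulrDr mulr_sumr exprMn exprS; congr (_ + _); first by ring.
  apply: eq_bigr => i _; rewrite exprMn.
  have iN : (i <= N)%N by rewrite -ltnS.
  by rewrite -[X in g ^+ X * _](subnK iN) exprD; ring.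
by rewrite E mulr0.
Qed.

(** For a submonoid [M] these polynomials form the monoid algebra of [M]; the coordinate rings of
    both cones are controlled in this way. *)
Definition supported M p := forall m, m \in msupp p -> M m.

Lemma supportedX M m : M m -> supported M 'X_[m].
Proof. by move=> Mm m'; rewrite msuppX inE => /eqP ->. Qed.

Lemma supported0 M : supported M 0.
Proof. by move=> m; rewrite msupp0. Qed.

Lemma supportedD M p q : supported M p -> supported M q -> supported M (p + q).
Proof.
by move=> Mp Mq m /msuppD_le; rewrite mem_cat => /orP[/Mp|/Mq].
Qed.

Lemma supportedZ M c p : supported M p -> supported M (c *: p).
Proof. by move=> Mp m /msuppZ_le /Mp. Qed.

Lemma supportedB M p q : supported M p -> supported M q -> supported M (p - q).
Proof. by move=> Mp Mq; rewrite -scaleN1r; apply/supportedD/supportedZ. Qed.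

Lemma supported_coeff M p m : supported M p -> ~~ M m -> p@_m = 0.
Proof. by move=> Mp; apply: contraNeq; rewrite mcoeff_eq0 negbK => /Mp. Qed.

Section Submonoid.
Variable M : pred 'X_{1..n}.
Hypothesis M0 : M 0%MM.
Hypothesis MD : forall m1 m2, M m1 -> M m2 -> M (m1 + m2)%MM.

Lemma supportedM p q : supported M p -> supported M q -> supported M (p * q).
Proof.
move=> Mp Mq m /msuppM_le /allpairsP[[m1 m2] /= [h1 h2 ->]].
by apply: MD; [apply: Mp|apply: Mq].
Qed.

Lemma supported1 : supported M 1.
Proof. by move=> m; rewrite msupp1 inE => /eqP ->. Qed.

Lemma supported_exp p k : supported M p -> supported M (p ^+ k).
Proof.
move=> Mp; elim: k => [|k IH]; first exact: supported1.
by rewrite exprS; apply: supportedM.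
Qed.

Lemma supported_comp l (f : l.-tuple {mpoly K[n]}) (p : {mpoly K[l]}) :
  (forall i, supported M (tnth f i)) -> supported M (p \mPo f).
Proof.
move=> Mf; rewrite comp_mpolyE; elim/big_ind: _.
- exact: supported0.
- exact: supportedD.
move=> m _; apply: supportedZ; elim/big_ind: _ => [||i _].
- exact: supported1.
- exact: supportedM.
- exact: supported_exp.
Qed.

(* The leading monomial of [w] is the quotient of those of [q * w] and [q];
   subtract the leading term and iterate. *)
Lemma supported_quotient q w :
  (forall m1 m2, M m1 -> M (m1 + m2)%MM -> M m2) ->
  q != 0 -> supported M q -> supported M (q * w) -> supported M w.
Proof.
move=> Mcancel q0 Mq; elim/mleadrect: w => w IH Mqw.
have [->|w0] := eqVneq w 0; first exact: supported0.
pose t := mleadc w *: 'X_[mlead w] : {mpoly K[n]}.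
have Mt : supported M t.
  apply/supportedZ/supportedX/(Mcancel (mlead q)); first exact/Mq/mlead_supp.
  by rewrite -mleadM //; apply/Mqw/mlead_supp; rewrite mulf_neq0.
rewrite -(subrK t w); apply: supportedD => //.
have [->|wt0] := eqVneq (w - t) 0; first exact: supported0.
apply: IH; first exact: ltm_mleadD.
by rewrite mulrBr; apply/supportedB/supportedM.
Qed.

End Submonoid.
End Divisibility.

(** * Polynomials viewed as univariate in the last variable *)

Section AsUnivariate.
Variables (n : nat) (K : fieldType).
Implicit Types (p : {mpoly K[n.+1]}).

Lemma muni_coef p (m : 'X_{1..n.+1}) :
  ((muni p)`_(m ord_max))@_[multinom m (widen_ord (leqnSn n) i) | i < n] = p@_m.
Proof.
rewrite muniE coef_sum raddf_sum /= [in RHS](mpolyE p) raddf_sum /=.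
apply: eq_bigr => m' _; rewrite !coefZ coefXn !mcoeffZ mcoeffX.
rewrite -!mul_mpolyC -mulrA mcoeffCM; congr (_ * _).
have [<-|neq] := eqVneq m' m; first by rewrite eqxx mulr1 mcoeffX eqxx.
case: eqVneq => [e|_]; last by rewrite mulr0 mcoeff0.
rewrite mulr1 mcoeffX; case: eqVneq => // /mnmP e'.
case/eqP: neq; apply/mnmP => i; case: (unliftP ord_max i) => [j ->|-> //].
have := e' j; rewrite !mnmE.
suff -> : lift ord_max j = widen_ord (leqnSn n) j by [].
by apply/val_inj; rewrite /= /bump leqNgt ltn_ord.
Qed.

Lemma muni_eq0 p : muni p = 0 -> p = 0.
Proof.
by move=> E; apply/mpolyP => m; rewrite -muni_coef E coef0 !mcoeff0.
Qed.

Lemma meval_muni (v : 'I_n.+1 -> K) p :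
  p.@[v] = (map_poly (meval (v \o widen_ord (leqnSn n))) (muni p)).[v ord_max].
Proof.
rewrite muniE mevalE rmorph_sum /= horner_sum; apply: eq_bigr => m _.
rewrite -mul_mpolyC -mul_polyC rmorphM /= map_polyC /= map_polyXn hornerM hornerC hornerXn.
rewrite mevalM mevalC mevalX big_ord_recr /= mulrA; congr (_ * _ * _).
by apply: eq_bigr => i _; rewrite mnmE.
Qed.

End AsUnivariate.

(** Induction on the number of variables: at a point where the leading coefficient in the last
    variable survives, a nonzero univariate polynomial remains. *)
Lemma mpoly_nonvanishing (K : numFieldType) n (p : {mpoly K[n]}) :
  p != 0 -> exists v : 'I_n -> K, p.@[v] != 0.
Proof.
elim: n p => [|n IH] p p0.
  exists (fun=> 0); apply: contra p0 => /eqP.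
  rewrite mevalE => E; apply/eqP/mpolyP => m; rewrite mcoeff0.
  have m0 m' : m' = 0%MM :> 'X_{1..0} by apply/mnmP => -[].
  rewrite (m0 m); case: (boolP (0%MM \in msupp p)) => [h|]; last by move/memN_msupp_eq0.
  move: E; rewrite (bigD1_seq 0%MM) ?msupp_uniq //= big_ord0 mulr1.
  by rewrite big1 ?addr0 // => m' ; rewrite (m0 m') eqxx.
have u0 : muni p != 0 by apply: contra p0 => /eqP /muni_eq0 ->.
have /IH[v lv] : lead_coef (muni p) != 0 by rewrite lead_coef_eq0.
set u := map_poly (meval v) (muni p).
have u'0 : u != 0.
  by apply: contraNneq lv => E; rewrite lead_coefE -coef_map -/u E coef0.
have [x ux] : exists x, u.[x] != 0.

  (* In characteristic zero these are [size u] distinct values, more than [u] can have roots. *)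
  pose s := [seq i%:R : K | i <- iota 0 (size u)].
  have us : uniq s by rewrite map_inj_uniq ?iota_uniq // => i j /eqP; rewrite eqr_nat => /eqP.
  case: (boolP (all (root u) s)) => [h|/allPn[x _ /negP h]]; last by exists x; apply/negP.
  by have := max_poly_roots u'0 h us; rewrite size_map size_iota ltnn.
exists (fun i => if unlift ord_max i is Some j then v j else x).
rewrite meval_muni unlift_none; congr (_ != 0): ux; congr (_.[_]).
apply: eq_map_poly => q; apply: meval_eq => i /=.
suff -> : widen_ord (leqnSn n) i = lift ord_max i by rewrite liftK.
by apply/val_inj; rewrite /= /bump leqNgt ltn_ord.
Qed.

(** * Local rings and normality *)

Lemma frac_quotient (D : idomainType) (z : {fraction D}) :
  exists a b : D, b != 0 /\ z * FracField.tofrac b = FracField.tofrac a.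
Proof.
elim/quotW: z => z.
exists (val z).1, (val z).2; split; first exact: denom_ratioP.
have -> (a b : {fraction D}) : a * b = FracField.mul a b by [].
apply/eqP; rewrite !piE.
rewrite FracField.equivfE /FracField.mulf !numden_Ratio ?(oner_eq0, mulf_neq0, denom_ratioP) //=.
by rewrite !mulr1 mulrC.
Qed.

Section IntegralClosure.
Variable A : comNzRingType.

(** A criterion that avoids the fraction field: writing [z = a / b] and multiplying its monic
    equation of degree [N] by [b ^+ N] gives a relation inside [A]. *)
Lemma integrally_closedI :
  (forall a b : A, a * b = 0 -> a = 0 \/ b = 0) ->
  (forall (a b : A) N (c : nat -> A), b != 0 ->
     a ^+ N + \sum_(i < N) c i * a ^+ i * b ^+ (N - i) = 0 -> exists w, a = b * w) ->
  integrally_closed_domain A.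
Proof.
move=> dom closed.
have domA : GRing.integral_domain_axiom A.
  by move=> a b /dom[] ->; rewrite eqxx ?orbT.
exists domA => z [p mp rp].
pose D : idomainType := domain_of domA.
have [a [b [b0 zb]]] : exists a b : D, b != 0 /\ z * FracField.tofrac b = FracField.tofrac a.
  exact: frac_quotient.
pose N := (size p).-1.
have sp : size p = N.+1 by rewrite prednK // size_poly_gt0 monic_neq0.
have E : a ^+ N + \sum_(i < N) p`_i * a ^+ i * b ^+ (N - i) = 0.
  have -> : a ^+ N + \sum_(i < N) p`_i * a ^+ i * b ^+ (N - i) =
      \sum_(i < N.+1) p`_i * a ^+ i * b ^+ (N - i).
    rewrite big_ord_recr /= subnn expr0 mulr1 addrC.
    by have /monicP := mp; rewrite lead_coefE sp /= => ->; rewrite mul1r.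
  apply/eqP; rewrite -tofrac_eq0 rmorph_sum /=.
  move: rp; rewrite /root (@horner_coef_wide _ N.+1); last first.
    by rewrite -sp size_poly.
  move=> /eqP rp; apply/eqP.
  transitivity (FracField.tofrac b ^+ N * 0); last by rewrite mulr0.
  rewrite -[in RHS]rp mulr_sumr; apply: eq_bigr => i _.
  have iN : (i <= N)%N by rewrite -ltnS.
  rewrite coef_map !tofracM !tofracXn -zb -[X in _ = _ ^+ X * _](subnK iN) exprD.
  by rewrite exprMn; ring.
have [w aw] := closed a b N (fun i => (p`_i : D)) b0 E.
exists w; apply: (mulIf (x := FracField.tofrac b)).
  by rewrite tofrac_eq0.
by rewrite zb aw -tofracM mulrC.
Qed.

(** The fraction [a / b] is a root of the monic polynomial ['X^2 - c%:P]. *)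
Lemma integrally_closed_sqrt (a b c : A) : integrally_closed_domain A ->
  b != 0 -> a ^+ 2 = b ^+ 2 * c -> exists w, a = b * w.
Proof.
move=> [domA closed]; pose D : idomainType := domain_of domA.
(* The elements are retyped in [D], which carries the domain structure required by the fraction
   field. *)
move: a b c; change (forall a b c : D, b != 0 -> a ^+ 2 = b ^+ 2 * c ->
  exists w : D, a = b * w) => a b c b0 E.
pose F := @FracField.tofrac D.
have Fb0 : F b != 0 by rewrite tofrac_eq0.
have /closed[w Ew] : integralOver F (F a / F b).
  exists ('X^2 - c%:P); first exact: monicXnsubC.
  rewrite /root rmorphB /= map_polyXn map_polyC /= !hornerE subr_eq0.
  rewrite expr_div_n -tofracXn E tofracM tofracXn.
  by rewrite mulrAC divff ?mul1r // expf_neq0.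
exists w; apply/eqP; rewrite -tofrac_eq tofracM.
by rewrite -Ew mulrC divfK.
Qed.

End IntegralClosure.

Section LocalRing.
Variables (R : realType) (n : nat) (X : set 'rV[R[i]]_n) (x : 'rV[R[i]]_n).
Variable (Xx : X x).
Local Notation P := {mpoly R[i][n]}.
Local Notation "p %:F" := (@FracField.tofrac P p).

Lemma regular_tofrac (p : P) : p%:F \in regular_at x.
Proof.
by apply/asboolP; exists p, 1; rewrite meval1 oner_neq0 tofrac1 divr1.
Qed.

Definition germ (p : P) : affine_local_ring x := exist _ (p%:F) (regular_tofrac p).

Lemma germ_is_zmod_morphism : zmod_morphism germ.
Proof. by move=> p q; apply/val_inj; rewrite rmorphB /= tofracB. Qed.

Lemma germ_is_monoid_morphism : monoid_morphism germ.
Proof.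
split=> [|p q]; apply/val_inj; first by rewrite rmorph1 /= tofrac1.
by rewrite rmorphM /= tofracM.
Qed.

HB.instance Definition _ := GRing.isZmodMorphism.Build P (affine_local_ring x)
  germ germ_is_zmod_morphism.
HB.instance Definition _ := GRing.isMonoidMorphism.Build P (affine_local_ring x)
  germ germ_is_monoid_morphism.

Definition localize : P -> local_ring Xx :=
  \pi_({ideal_quot (local_ideal Xx)}) \o germ.

HB.instance Definition _ := GRing.RMorphism.on localize.

(** The fraction of [p] over [1] equals some [f / g] with [f] vanishing on [X] exactly when
    [g * p = f]. *)
Lemma localize_eq0 p : localize p = 0 <->
  exists2 g : P, g.@[x 0] != 0 & vanishing_on X (g * p).
Proof.
have -> : localize p = 0 <-> germ p \in local_ideal Xx.
  rewrite -[germ p]subr0 Quotient.idealrBE.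
  split=> [E|/eqP E]; last by rewrite /localize /= E rmorph0.
  by apply/eqP; rewrite [RHS]rmorph0; exact: E.
split=> [/asboolP[f [g [fX g0 /= E]]]|[g g0 gX]].
  exists g => //; suff -> : g * p = f by [].
  apply/eqP; rewrite -tofrac_eq tofracM E mulrC divfK //.
  exact: tofrac_neq0_at g0.
apply/asboolP; exists (g * p), g; split=> //=.
by rewrite tofracM mulrAC divff ?mul1r // (tofrac_neq0_at g0).
Qed.

Lemma localize_unit g : g.@[x 0] != 0 -> exists y, y * localize g = 1.
Proof.
move=> g0.
have h : (1 / g%:F) \in regular_at x.
  by apply/asboolP; exists 1, g; rewrite tofrac1.
pose y : affine_local_ring x := exist (fun z => z \in regular_at x) _ h.
exists (\pi_({ideal_quot (local_ideal Xx)}) y).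
rewrite /localize /= -rmorphM; suff -> : y * germ g = 1 by rewrite rmorph1.
apply/val_inj; rewrite rmorphM rmorph1 /= divfK //.
exact: tofrac_neq0_at g0.
Qed.

Lemma localize_fraction (a : local_ring Xx) :
  exists f g : P, g.@[x 0] != 0 /\ localize g * a = localize f.
Proof.
elim/quotW: a => z; have /asboolP[f [g [g0 E]]] := valP z.
exists f, g; split=> //; rewrite /localize /= -rmorphM; congr (\pi _).
apply/val_inj; rewrite rmorphM /= E mulrC divfK //.
exact: tofrac_neq0_at g0.
Qed.

End LocalRing.

Section Composition.
Variables (K : comNzRingType) (n l : nat) (f : n.-tuple {mpoly K[l]}).
Implicit Types p q : {mpoly K[n]}.

Lemma comp_mpolyM p q : (p * q) \mPo f = (p \mPo f) * (q \mPo f).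
Proof. exact: (rmorphM (comp_mpoly f)). Qed.

Lemma comp_mpolyXn p k : (p ^+ k) \mPo f = (p \mPo f) ^+ k.
Proof. exact: (rmorphXn (comp_mpoly f)). Qed.

Lemma comp_mpoly_sum (I : Type) (s : seq I) (F : I -> {mpoly K[n]}) :
  (\sum_(i <- s) F i) \mPo f = \sum_(i <- s) (F i \mPo f).
Proof. exact: (raddf_sum (comp_mpoly f)). Qed.

Lemma mevalXn (v : 'I_n -> K) p k : (p ^+ k).@[v] = p.@[v] ^+ k.
Proof. exact: (rmorphXn (meval v)). Qed.

End Composition.

(** * Images of polynomial maps and their local rings *)

Section PolynomialImage.
Variables (R : realType) (r n : nat) (psi : n.-tuple {mpoly R[i][r]}).
Implicit Types (p q g f : {mpoly R[i][n]}).

Definition poly_image : set 'rV[R[i]]_n :=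
  [set y | exists v : 'I_r -> R[i], y = \row_i (tnth psi i).@[v]].

Lemma meval_poly_image p v :
  p.@[(\row_i (tnth psi i).@[v]) 0] = (p \mPo psi).@[v].
Proof. by rewrite comp_mpoly_meval; apply: meval_eq => i; rewrite mxE. Qed.

(** A polynomial in the parameters that is zero at every point is zero. The coordinate ring of the
    image is thus the ring of all [h \mPo psi]. *)
Lemma vanishing_poly_image p : vanishing_on poly_image p <-> p \mPo psi = 0.
Proof.
split=> [pX|p0 y [v ->]]; last by rewrite meval_poly_image p0 meval0.
apply/eqP/negP => /negP/mpoly_nonvanishing[v /negP]; apply.
by rewrite -meval_poly_image pX //; exists v.
Qed.

Lemma comp_poly_image_neq0 g y : poly_image y -> g.@[y 0] != 0 -> g \mPo psi != 0.
Proof.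
by move=> Xy; apply: contraNneq => /vanishing_poly_image/(_ _ Xy) ->.
Qed.

End PolynomialImage.

(* [loc] is an abstract localization of the coordinate ring of the image of [psi]
   at the multiplicative set [S]. *)
Section Localization.
Variables (K : fieldType) (r n : nat) (psi : n.-tuple {mpoly K[r]}).
Variables (A : comNzRingType) (loc : {rmorphism {mpoly K[n]} -> A}).
Variable S : pred {mpoly K[n]}.
Hypothesis S1 : S 1.
Hypothesis SM : forall p q, S p -> S q -> S (p * q).
Hypothesis S_neq0 : forall g, S g -> g \mPo psi != 0.
Hypothesis loc_eq0 : forall p, loc p = 0 <-> p \mPo psi = 0.
Hypothesis loc_unit : forall g, S g -> exists y, y * loc g = 1.
Hypothesis loc_fraction : forall a : A, exists f g, S g /\ loc g * a = loc f.

Lemma loc_eq p q : p \mPo psi = q \mPo psi -> loc p = loc q.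
Proof.
move=> E; apply/eqP; rewrite -subr_eq0 -rmorphB; apply/eqP/loc_eq0.
by rewrite comp_mpolyB E subrr.
Qed.

Lemma loc_mulI g : S g -> injective ( *%R (loc g)).
Proof.
move=> /loc_unit[y yg] a b E.
by rewrite -[a]mul1r -yg -mulrA E mulrA yg mul1r.
Qed.

Lemma common_denominator N (c : nat -> A) :
  exists g (f : nat -> {mpoly K[n]}), S g /\
    forall i, (i < N)%N -> loc g * c i = loc (f i).
Proof.
elim: N => [|N [g [f [Sg E]]]]; first by exists 1, (fun=> 0).
have [f' [g' [Sg' E']]] := loc_fraction (c N).
exists (g * g'), (fun i => if (i < N)%N then f i * g' else f' * g).
split=> [|i]; first exact: SM.
rewrite ltnS leq_eqVlt => /orP[/eqP ->|iN].
  by rewrite ltnn !rmorphM -E' mulrAC mulrC mulrA mulrAC.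
by rewrite iN !rmorphM -E // mulrAC.
Qed.

Lemma loc_domain (a b : A) : a * b = 0 -> a = 0 \/ b = 0.
Proof.
have [f [g [Sg Ea]]] := loc_fraction a.
have [f' [g' [Sg' Eb]]] := loc_fraction b.
move=> ab0; have /loc_eq0 : loc (f * f') = 0.
  by rewrite rmorphM -Ea -Eb mulrACA ab0 mulr0.
rewrite comp_mpolyM => /eqP; rewrite mulf_eq0 => /orP[]/eqP/loc_eq0 E.
  by left; apply: (loc_mulI Sg); rewrite Ea E mulr0.
by right; apply: (loc_mulI Sg'); rewrite Eb E mulr0.
Qed.

(** The hypothesis says that the ring of all [h \mPo psi] is the intersection of its fraction field
    with the polynomial ring. Clearing denominators turns an integral relation over [A] into one
    between polynomials with leading coefficient [g]; [integral_relation_divides] solves it there,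
    and the hypothesis brings the quotient back. *)
Lemma loc_integrally_closed :
  (forall g f w, g \mPo psi != 0 -> (g \mPo psi) * w = f \mPo psi ->
     exists h, w = h \mPo psi) ->
  integrally_closed_domain A.
Proof.
move=> closed; apply: integrally_closedI; first exact: loc_domain.
move=> a b N c b0 E.
have [fa [ga [Sga Ea]]] := loc_fraction a.
have [fb [gb [Sgb Eb]]] := loc_fraction b.
have [g [cf [Sg Ec]]] := common_denominator N c.
(* With one denominator [u] for both [a] and [b], the homogeneous relation is just multiplied by [u]
   to the power [N]. *)
have [u [F [H [Su uF uH]]]] : exists u F H,
    [/\ S u, loc u * a = loc F & loc u * b = loc H].
  exists (ga * gb), (fa * gb), (fb * ga).
  split; first exact: SM.
    by rewrite !rmorphM -Ea mulrAC.
  by rewrite !rmorphM -Eb mulrAC [RHS]mulrAC [loc gb * _]mulrC mulrAC.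
have g0 := S_neq0 Sg.
have H0 : H \mPo psi != 0.
  apply: contraNneq b0 => /loc_eq0 H0.
  by apply/eqP/(loc_mulI Su); rewrite mulr0 -H0.
have : loc (g * F ^+ N + \sum_(i < N) cf i * F ^+ i * H ^+ (N - i)) = 0.
  transitivity (loc g * loc u ^+ N *
      (a ^+ N + \sum_(i < N) c i * a ^+ i * b ^+ (N - i))); last by rewrite E mulr0.
  rewrite rmorphD rmorphM rmorphXn -uF exprMn mulrDr mulrA; congr (_ + _).
  rewrite rmorph_sum mulr_sumr; apply: eq_bigr => i _.
  rewrite !rmorphM !rmorphXn -uF -uH -Ec //.
  by rewrite -[X in loc u ^+ X](subnK (ltnW (ltn_ord i))) exprD !exprMn; ring.
move=> /loc_eq0; rewrite comp_mpolyD comp_mpolyM comp_mpolyXn comp_mpoly_sum => E'.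
have [|w Ew] := @integral_relation_divides _ _ (g \mPo psi) (F \mPo psi) (H \mPo psi) N
  (fun i => cf i \mPo psi) g0 H0.
  rewrite -[RHS]E'; congr (_ + _); apply: eq_bigr => i _.
  by rewrite !comp_mpolyM !comp_mpolyXn.
have [|h Eh] := closed H (g * F) w H0; first by rewrite comp_mpolyM Ew.
have [y yg] := loc_unit Sg.
exists (loc h * y); apply: (loc_mulI Su).
have gF : loc g * loc F = loc H * loc h.
  by rewrite -!rmorphM; apply: loc_eq; rewrite !comp_mpolyM Ew Eh.
transitivity (y * (loc g * loc F)); first by rewrite mulrA yg mul1r.
by rewrite gF -uH; ring.
Qed.

(* The hypotheses say that [a / b] is a square root of [c] in the fraction
   field of the coordinate ring; the conclusion, that it belongs to [A]. *)
Lemma loc_sqrt (a b c : {mpoly K[n]}) :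
  integrally_closed_domain A -> b \mPo psi != 0 ->
  (a \mPo psi) ^+ 2 = (b \mPo psi) ^+ 2 * (c \mPo psi) ->
  exists g w, S g /\ (g \mPo psi) * (a \mPo psi) = (b \mPo psi) * (w \mPo psi).
Proof.
move=> cA b0 E.
have [||w Ew] := @integrally_closed_sqrt _ (loc a) (loc b) (loc c) cA.
- by apply: contraNneq b0 => /loc_eq0 ->.
- rewrite -!rmorphXn -rmorphM; apply: loc_eq.
  by rewrite comp_mpolyXn E -comp_mpolyXn -comp_mpolyM.
have [f [g [Sg Eg]]] := loc_fraction w.
exists g, f; split=> //; apply/eqP; rewrite -subr_eq0 -!comp_mpolyM -comp_mpolyB.
apply/eqP/loc_eq0; rewrite rmorphB !rmorphM -Eg Ew; ring.
Qed.

End Localization.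

Section NormalityOfImage.
Variables (R : realType) (r n : nat) (psi : n.-tuple {mpoly R[i][r]}).
Local Notation X := (poly_image psi).
Variables (x : 'rV[R[i]]_n) (Xx : X x).

Definition nonzero_at : pred {mpoly R[i][n]} := fun g => g.@[x 0] != 0.

Lemma nonzero_at1 : nonzero_at 1.
Proof. by rewrite /nonzero_at meval1 oner_neq0. Qed.

Lemma nonzero_atM p q : nonzero_at p -> nonzero_at q -> nonzero_at (p * q).
Proof. by rewrite /nonzero_at mevalM; apply: mulf_neq0. Qed.

(** Denominators stay nonzero after composition with [psi] into a domain, so localizing kills no
    further functions. *)
Lemma localize_image_eq0 p : localize Xx p = 0 <-> p \mPo psi = 0.
Proof.
rewrite localize_eq0; split=> [[g g0 /vanishing_poly_image]|p0].
  rewrite comp_mpolyM => /eqP; rewrite mulf_eq0 => /orP[]/eqP E; last exact: E.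
  by case/negP: (comp_poly_image_neq0 Xx g0); rewrite E.
exists 1; first exact: nonzero_at1.
by rewrite mul1r; apply/vanishing_poly_image.
Qed.

End NormalityOfImage.

Lemma normal_poly_image (R : realType) r n (psi : n.-tuple {mpoly R[i][r]}) :
  (forall g f w, g \mPo psi != 0 -> (g \mPo psi) * w = f \mPo psi ->
     exists h, w = h \mPo psi) ->
  normal_variety (poly_image psi).
Proof.
move=> closed x Xx.
apply: (@loc_integrally_closed _ _ _ psi _ (localize Xx) (nonzero_at x)) closed.
- exact: nonzero_at1.
- exact: nonzero_atM.
- by move=> g; apply: comp_poly_image_neq0.
- exact: localize_image_eq0.
- exact: localize_unit.
- exact: localize_fraction.
Qed.

Lemma normal_image_sqrt (R : realType) r n (psi : n.-tuple {mpoly R[i][r]})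
    (x : 'rV[R[i]]_n) (a b c : {mpoly R[i][n]}) :
  normal_variety (poly_image psi) -> poly_image psi x -> b \mPo psi != 0 ->
  (a \mPo psi) ^+ 2 = (b \mPo psi) ^+ 2 * (c \mPo psi) ->
  exists g w, g.@[x 0] != 0 /\
    (g \mPo psi) * (a \mPo psi) = (b \mPo psi) * (w \mPo psi).
Proof.
move=> nX Xx; apply: (@loc_sqrt _ _ _ psi _ (localize Xx) (nonzero_at x)) (nX x Xx).
- exact: localize_image_eq0.
- exact: localize_fraction.
Qed.

(** * Dimension *)

Section AlgebraicDependence.
Variables (K : fieldType) (r e : nat) (f : e.-tuple {mpoly K[r]}).

Lemma msizeM_leS (p q : {mpoly K[r]}) a b :
  (msize p <= a.+1)%N -> (msize q <= b.+1)%N -> (msize (p * q) <= (a + b).+1)%N.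
Proof.
have [->|p0] := eqVneq p 0; first by rewrite mul0r msize0.
have [->|q0] := eqVneq q 0; first by rewrite mulr0 msize0.
move=> pa qb; rewrite msizeM //.
by move: (msize p) (msize q) pa qb => x y; lia.
Qed.

Lemma msize_expr_le (p : {mpoly K[r]}) D k :
  (msize p <= D.+1)%N -> (msize (p ^+ k) <= (k * D).+1)%N.
Proof.
move=> h; elim: k => [|k IH]; first by rewrite msize1.
by rewrite exprS mulSn; apply: msizeM_leS.
Qed.

Lemma msize_comp_mpolyX_le D (m : 'X_{1..e}) :
  (forall i, (msize (tnth f i) <= D.+1)%N) ->
  (msize ('X_[m] \mPo f) <= (\sum_(i < e) m i * D).+1)%N.
Proof.
move=> fD; rewrite comp_mpolyX.
elim/big_rec2: _ => [|i k p _ h]; first by rewrite msize1.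
exact: msizeM_leS (msize_expr_le _ _) h.
Qed.

(** Indexing monomials by a finite function type lets them be counted by [card_ffun] and serve as
    matrix indices. *)
Definition bounded_mnm N l (t : {ffun 'I_l -> 'I_N}) : 'X_{1..l} :=
  [multinom (t i : nat) | i < l].

Lemma bounded_mnm_inj N l : injective (@bounded_mnm N l).
Proof.
by move=> s t /mnmP E; apply/ffunP => i; apply/val_inj; have := E i; rewrite !mnmE.
Qed.

Lemma bounded_mnmP N l (m : 'X_{1..l}) :
  (forall i, (m i < N)%N) -> exists t, m = @bounded_mnm N l t.
Proof.
move=> h; exists [ffun i => Ordinal (h i)].
by apply/mnmP => i; rewrite mnmE ffunE.
Qed.

(* Both sides of [c ^ r * N ^ r < N ^ e] count monomials: for [N] large there are
   more monomials in the [f i] with exponents below [N] than monomials in [r]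
   variables that can occur in them. *)
Lemma algebraic_dependence : (r < e)%N ->
  exists2 Q : {mpoly K[e]}, Q != 0 & Q \mPo f = 0.
Proof.
move=> re.
pose D := \max_(i < e) msize (tnth f i).
have fD i : (msize (tnth f i) <= D.+1)%N by apply: leqW; apply: leq_bigmax.
(* Exponents below [N] give degree at most [e * N * D < M], and [c ^ r < N] gives
   [M ^ r < N ^ r.+1 <= N ^ e]. *)
pose c := (e * D).+1; pose N := (c ^ r).+1; pose M := (c * N)%N.
pose T1 : finType := {ffun 'I_e -> 'I_N}; pose T2 : finType := {ffun 'I_r -> 'I_M}.
have card12 : (#|T2| < #|T1|)%N.
  rewrite !card_ffun !card_ord expnMn.
  apply: (@leq_trans (N ^ r.+1)%N); last by rewrite leq_pexp2l.
  by rewrite expnS ltn_pmul2r // expn_gt0.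
(* Each row lists the coefficients of one monomial in the [f i]. There are more rows than columns,
   and a vector of the left kernel provides the coefficients of [Q]. *)
pose A : 'M[K]_(#|T1|, #|T2|) := \matrix_(i, j)
  ('X_[bounded_mnm (enum_val i)] \mPo f)@_(bounded_mnm (enum_val j)).
have /rowV0Pn[u /sub_kermxP uA u0] : kermx A != 0.
  rewrite -mxrank_eq0 mxrank_ker subn_eq0 -ltnNge.
  by apply: leq_ltn_trans card12; apply: rank_leq_col.
exists (\sum_i u 0 i *: 'X_[bounded_mnm (enum_val i)]).
  apply: contraNneq u0 => /mpolyP E; apply/eqP/rowP => i; rewrite mxE.
  have := E (bounded_mnm (enum_val i)); rewrite mcoeff0 => <-.
  rewrite raddf_sum (bigD1 i) //= mcoeffZ mcoeffX eqxx mulr1 big1 ?addr0 // => j ji.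
  rewrite mcoeffZ mcoeffX (inj_eq (@bounded_mnm_inj _ _)) (inj_eq enum_val_inj).
  by rewrite (negbTE ji) mulr0.
rewrite raddf_sum /=; apply/mpolyP => m; rewrite mcoeff0 raddf_sum /=.
(* A monomial with all exponents below [M] is a column of [A]; any other one has too large a degree
   to occur. *)
case: (pickP (fun i => M <= m i)%N) => [i Mi|h]; last first.
  have [|t ->] := @bounded_mnmP M r m; first by move=> i; rewrite ltnNge h.
  have := congr1 (fun B : 'rV_(_) => B 0 (enum_rank t)) uA; rewrite !mxE => E.
  by rewrite -[RHS]E; apply: eq_bigr => i _; rewrite comp_mpolyZ mcoeffZ mxE enum_rankK.
rewrite big1 // => j _; rewrite comp_mpolyZ mcoeffZ.
rewrite [X in _ * X]memN_msupp_eq0 ?mulr0 //; apply: msize_mdeg_ge.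
apply: leq_trans (msize_comp_mpolyX_le _ fD) _.
apply: leq_trans (_ : m i <= _)%N; last by rewrite mdegE (bigD1 i) //= leq_addr.
apply: leq_trans Mi; rewrite /M /c.
have : (\sum_(i < e) bounded_mnm (enum_val j) i * D <= \sum_(i < e) N * D)%N.
  by apply: leq_sum => l _; rewrite leq_mul2r mnmE ltnW ?orbT.
rewrite sum_nat_const card_ord mulnCA => /leq_ltn_trans; apply.
by rewrite mulSn addnC mulnC -addn1 leq_add2l.
Qed.

End AlgebraicDependence.

(** * Irreducible closed sets and lengths of chains *)

Section Dimension.
Variable R : realType.
Local Notation C := R[i].

Section AmbientSpace.
Variable n : nat.
Implicit Types (X Z : set 'rV[C]_n) (p q : {mpoly C[n]}).

Lemma algebraic_setP X : algebraic_set X <->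
  forall y : 'rV[C]_n, (forall p, vanishing_on X p -> p.@[y 0] = 0) -> X y.
Proof.
split=> [[S ->] y h p Sp|h]; first by apply: h => z; apply.
exists (vanishing_on X); apply/seteqP; split=> y; last exact: h.
by move=> Xy p; apply.
Qed.

Lemma algebraic_zeros p : algebraic_set [set y : 'rV[C]_n | p.@[y 0] = 0].
Proof. by apply/algebraic_setP => y; apply. Qed.

Lemma irreducible_vanishingM Z p q : irreducible_set Z ->
  vanishing_on Z (p * q) -> vanishing_on Z p \/ vanishing_on Z q.
Proof.
move=> [_ irr] pq; apply: irr; [exact: algebraic_zeros..|].
move=> y /pq; rewrite mevalM => /eqP; rewrite mulf_eq0.
by case/orP => /eqP; [left|right].
Qed.

Lemma algebraic_separation Z A : algebraic_set A -> ~ (Z `<=` A) ->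
  exists2 p, vanishing_on A p & ~ vanishing_on Z p.
Proof.
move=> [S ->] /existsNP[z /not_implyP[Zz /existsNP[p /not_implyP[Sp pz]]]].
exists p => [y|pZ]; first exact.
exact/pz/pZ.
Qed.

(** The vanishing ideal is the kernel of a morphism to a domain, hence prime. *)
Lemma irreducible_poly_image r (psi : n.-tuple {mpoly C[r]}) :
  irreducible_set (poly_image psi).
Proof.
split; first by exists (\row_i (tnth psi i).@[fun=> 0]), (fun=> 0).
move=> A B algA algB sub.
case: (pselect (poly_image psi `<=` A)) => [|nA]; first by left.
case: (pselect (poly_image psi `<=` B)) => [|nB]; first by right.
have [p pA pX] := algebraic_separation algA nA.
have [q qB qX] := algebraic_separation algB nB.
have /vanishing_poly_image : vanishing_on (poly_image psi) (p * q).
  by move=> y /sub[/pA|/qB] E; rewrite mevalM E ?mul0r ?mulr0.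
rewrite comp_mpolyM => /eqP; rewrite mulf_eq0.
by case/orP => /eqP /vanishing_poly_image.
Qed.

(** Induction on [e]: strip from [Q] the largest power of its last variable. As [f e] does not
    vanish on the irreducible set [F e.+1], the remaining factor does. On [F e], where [f e] is
    zero, only its constant coefficient survives; by induction that coefficient is zero, against the
    maximality of the power. *)
Lemma chain_independent e (F : nat -> set 'rV[C]_n) (f : nat -> {mpoly C[n]}) :
  (forall i, (i <= e)%N -> irreducible_set (F i)) ->
  (forall i, (i < e)%N -> F i `<=` F i.+1) ->
  (forall i, (i < e)%N -> vanishing_on (F i) (f i) /\ ~ vanishing_on (F i.+1) (f i)) ->
  forall Q : {mpoly C[e]},
    vanishing_on (F e) (Q \mPo [tuple f i | i < e]) -> Q = 0.
Proof.
elim: e => [|e IH] irr sub sep Q QF.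
  have [y Fy] := (irr 0 (leqnn 0)).1.
  apply/eqP/negP => /negP/mpoly_nonvanishing[v /negP]; apply.
  by rewrite -(QF y Fy) comp_mpoly_meval; apply/eqP/meval_eq => -[].
have [fe0 fe] := sep e (ltnSn e).
pose ev (s : {poly {mpoly C[e]}}) :=
  (map_poly (comp_mpoly [tuple f i | i < e]) s).[f e].
have evE s (y : 'rV[C]_n) : (ev s).@[y 0] =
    (map_poly (meval (fun i : 'I_e => (f i).@[y 0])) s).[(f e).@[y 0]].
  rewrite /ev -horner_map -map_poly_comp; congr (_.[_]); apply: eq_map_poly => p /=.
  by rewrite comp_mpoly_meval; apply: meval_eq => i; rewrite tnth_mktuple.
apply/eqP/negP => /negP Q0.
have u0 : muni Q != 0 by apply: contra Q0 => /eqP /muni_eq0 ->.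
(* The cofactor [q] does not have [0] as a root, which the rest of the proof contradicts. *)
have [k [q + E]] := multiplicity_XsubC (muni Q) 0; rewrite u0 /= => /negP; apply.
have : vanishing_on (F e.+1) (f e ^+ k * ev q).
  move=> y Fy; have := QF y Fy; rewrite comp_mpoly_meval meval_muni.
  rewrite tnth_mktuple E subr0 rmorphM hornerM /= map_polyXn hornerXn => <-.
  rewrite [RHS]mulrC mevalM evE mevalXn; congr (_ * (horner _ _)).
  by apply: eq_map_poly => p; apply: meval_eq => i /=; rewrite tnth_mktuple.
move=> /(irreducible_vanishingM (irr _ (leqnn _)))[fek|evq].
  case: fe => y /fek; rewrite mevalXn => /eqP; rewrite expf_eq0.
  by case/andP => _ /eqP.
rewrite /root horner_coef0; apply/eqP/IH.
- by move=> i /leqW; apply: irr.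
- by move=> i /leqW; apply: sub.
- by move=> i /leqW; apply: sep.
move=> y Fy; have := evq y (sub e (ltnSn e) y Fy).
rewrite evE (fe0 y Fy) horner_coef0 coef_map /= => <-.
by rewrite comp_mpoly_meval; apply: meval_eq => i; rewrite tnth_mktuple.
Qed.

End AmbientSpace.

Variables (r n : nat) (psi : n.-tuple {mpoly C[r]}).

(** Polynomials separating consecutive members of the chain are independent on [F e], but if [r < e]
    their composites with [psi] are [e] polynomials in [r] variables, hence dependent. *)
Lemma chain_length_poly_image e F :
  irreducible_chain (poly_image psi) e F -> (e <= r)%N.
Proof.
move=> [irr strict].
have /choice[f fP] : forall i, exists p, (i < e)%N ->
    vanishing_on (F i) p /\ ~ vanishing_on (F i.+1) p.
  move=> i; case: (boolP (i < e)%N) => [ie|]; last by exists 0.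
  have [algF _ _] := irr i (ltnW ie); have [_ nF] := strict i ie.
  by have [p] := algebraic_separation algF nF; exists p.
rewrite leqNgt; apply/negP => re.
have [Q Q0 Qf] := algebraic_dependence [tuple f i \mPo psi | i < e] re.
case/negP: Q0; apply/eqP; apply: (@chain_independent n e F f) => //.
- by move=> i /irr[].
- by move=> i /strict[].
have [_ _ FX] := irr e (leqnn e) => y /FX[v ->].
rewrite meval_poly_image.
transitivity ((Q \mPo [tuple f i \mPo psi | i < e]).@[v]); last by rewrite Qf meval0.
rewrite !comp_mpoly_meval; apply: meval_eq => i.
by rewrite !tnth_mktuple comp_mpoly_meval.
Qed.

(* The chain is made of the images of the coordinate subspaces
   [v_0 = ... = v_(r - j - 1) = 0], which the coordinates [theta i] cut out of the image. *)
Lemma has_dimension_poly_image (theta : 'I_r -> 'I_n) :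
  algebraic_set (poly_image psi) ->
  (forall v i, (tnth psi (theta i)).@[v] = 0 <-> v i = 0) ->
  has_dimension (poly_image psi) r.
Proof.
move=> algX thetaE; split; last by move=> e [F]; apply: chain_length_poly_image.
pose F j := [set y : 'rV[C]_n | poly_image psi y /\
  forall i : 'I_r, (i < r - j)%N -> y 0 (theta i) = 0].
exists F; split=> [j _|j jr]; last first.
  split=> [y [Xy y0]|sub].
    by split=> // i ij; apply: y0; apply: leq_trans ij _; rewrite leq_sub2l.
  have kr : (r - j.+1 < r)%N by rewrite ltn_subrL (leq_ltn_trans _ jr).
  (* The image of this unit vector lies in [F j.+1] but not in [F j], since only its parameter of
     index [r - j - 1] is nonzero. *)
  pose v (i : 'I_r) : C := (i == Ordinal kr)%:R.
  have /sub[_] : F j.+1 (\row_i (tnth psi i).@[v]).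
    split=> [|i ij]; first by exists v.
    rewrite mxE; apply/thetaE; rewrite /v; case: eqP ij => // ->.
    by rewrite ltnn.
  move=> /(_ (Ordinal kr)); rewrite mxE /= subnSK // => /(_ (leqnn _)) /thetaE.
  by rewrite /v eqxx => /eqP; rewrite oner_eq0.
split; last by move=> y [].
- apply/algebraic_setP => y h; split.
    by move/algebraic_setP: algX; apply => p pX; apply: h => z [/pX].
  move=> i ij; rewrite -(mevalXU (y 0) (theta i)); apply: h => z [_ /(_ _ ij)].
  by rewrite mevalXU.
(* Substituting zero for the first [r - j] parameters exhibits [F j] as a polynomial image, hence as
   irreducible. *)
pose cut : r.-tuple {mpoly C[r]} := [tuple if (i < r - j)%N then 0 else 'X_i | i < r].
have -> : F j = poly_image [tuple tnth psi i \mPo cut | i < n].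
  apply/seteqP; split=> y.
    move=> [[v ->] y0]; exists v; apply/rowP => i; rewrite !mxE tnth_mktuple.
    rewrite comp_mpoly_meval; apply: meval_eq => l; rewrite tnth_mktuple.
    case: ifP => lj; last by rewrite mevalXU.
    by rewrite meval0; apply/thetaE; have := y0 l lj; rewrite mxE.
  move=> [v ->]; split.
    exists (fun l => (tnth cut l).@[v]); apply/rowP => i; rewrite !mxE tnth_mktuple.
    by rewrite comp_mpoly_meval.
  move=> i ij; rewrite !mxE tnth_mktuple comp_mpoly_meval; apply/thetaE.
  by rewrite tnth_mktuple ij meval0.
exact: irreducible_poly_image.
Qed.

End Dimension.

(** * Lipschitz maps *)

Import ComplexField.Normc.

Section EuclideanNorm.
Variable R : realType.
Local Notation C := R[i].

Lemma normc_ge0 (z : C) : 0 <= normc z.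
Proof. by case: z => a b; apply: sqrtr_ge0. Qed.

Lemma normc_normE (z : C) : `|z| = (normc z)%:C%C.
Proof. by rewrite normc_def; case: z. Qed.

Lemma normc_sub (z w : C) : normc (z - w) <= normc z + normc w.
Proof.
by rewrite -(normcN w); apply: le_normcD.
Qed.

Lemma euclidean_norm_ge0 k (x : 'rV[C]_k) : 0 <= euclidean_norm x.
Proof. exact: sqrtr_ge0. Qed.

Lemma sqr_euclidean_norm k (x : 'rV[C]_k) :
  euclidean_norm x ^+ 2 = \sum_(i < k) normc (x 0 i) ^+ 2.
Proof. by rewrite sqr_sqrtr // sumr_ge0 // => i _; rewrite sqr_ge0. Qed.

Lemma normc_le_euclidean_norm k (x : 'rV[C]_k) i : normc (x 0 i) <= euclidean_norm x.
Proof.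
rewrite -(ler_pXn2r (n := 2)) ?nnegrE ?normc_ge0 ?euclidean_norm_ge0 //.
rewrite sqr_euclidean_norm (bigD1 i) //= lerDl sumr_ge0 // => j _.
exact: sqr_ge0.
Qed.

(** The factor [k.+1] is cruder than the square root of [k], but it is also positive for [k = 0] and
    can be divided by. *)
Lemma euclidean_norm_le k (x : 'rV[C]_k) d : 0 <= d ->
  (forall i, normc (x 0 i) <= d) -> euclidean_norm x <= k.+1%:R * d.
Proof.
move=> d0 xd; rewrite -(ler_pXn2r (n := 2)) ?nnegrE ?euclidean_norm_ge0 ?mulr_ge0 //.
rewrite sqr_euclidean_norm (le_trans (_ : _ <= \sum_(i < k) d ^+ 2)) //.
  by apply: ler_sum => i _; rewrite ler_pXn2r ?nnegrE ?normc_ge0.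
rewrite sumr_const card_ord exprMn -[leLHS]mulr_natl ler_wpM2r ?sqr_ge0 //.
by rewrite -natrX ler_nat; nia.
Qed.

Lemma lipschitz_continuous_on k l (A : set 'rV[C]_k) (f : 'rV[C]_k -> 'rV[C]_l) (K : R) :
  0 < K ->
  (forall x x', A x -> A x' ->
     euclidean_norm (f x - f x') <= K * euclidean_norm (x - x')) ->
  continuous_on A f.
Proof.
move=> K0 lip; apply/subspace_continuousP => x Ax.
apply/cvg_ballP => e e0.
(* Radii of balls over [C] are complex numbers; a positive one is real. *)
have er : e = (complex.Re e)%:C%C by rewrite complex.RRe_real // gtr0_real.
have r0 : 0 < complex.Re e by rewrite -ltcR -er.
(* Balls are taken entrywise: [k.+1] passes from entries to the Euclidean norm, and halving makes
   the final inequality strict. *)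
pose d := complex.Re e / (K * k.+1%:R) / 2.
have d0 : 0 < d by rewrite !divr_gt0 // mulr_gt0.
near=> y.
have Ay : A y by near: y; exact: withinT.
have : ball (x : 'rV[C^o]_k) (d%:C%C : C^o) y.
  near: y; rewrite near_withinE; near=> z => _; near: z.
  by apply: nbhsx_ballx; rewrite ltcR.
move=> [_ xy]; split=> // i j; rewrite -ball_normE /= normc_normE er ltcR.
have -> : f x i j - f y i j = (f x - f y) 0 j by rewrite (ord1 i) !mxE.
apply: le_lt_trans (normc_le_euclidean_norm _ _) _.
apply: le_lt_trans (lip _ _ Ax Ay) _.
have : euclidean_norm (x - y) <= k.+1%:R * d.
  apply: euclidean_norm_le => [|l0]; first exact: ltW.
  have := xy 0 l0; rewrite -ball_normE /= normc_normE ltcR => /ltW.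
  by rewrite !mxE.
rewrite -(ler_pM2l K0) => /le_lt_trans; apply.
have -> : K * (k.+1%:R * d) = complex.Re e / 2.
  have N0 : K * k.+1%:R != 0 by rewrite mulf_neq0 ?gt_eqF.
  by rewrite mulrA /d mulrA [X in X / 2]mulrC divfK.
by rewrite ltr_pdivrMr // ltr_pMr // ltr1n.
Unshelve. all: by end_near. Qed.

End EuclideanNorm.

(** * The quartic cone and its projection *)

Section QuarticCurve.
Variable R : realType.
Local Notation C := R[i].

(** For [a != 0], [s] is a fourth root of [a], [t = b / s ^+ 3], and the rest follows by cancelling
    [a]. For [a = 0] only [e] can be nonzero. *)
Lemma quartic_cone_param (a b c d e : C) :
  a * c = b ^+ 2 -> c * e = d ^+ 2 -> a * e = c ^+ 2 -> a * d = b * c ->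
  exists s t, [/\ a = s ^+ 4, b = s ^+ 3 * t, c = s ^+ 2 * t ^+ 2,
                  d = s * t ^+ 3 & e = t ^+ 4].
Proof.
move=> acb ced aec adb.
have rK (z : C) : (4.-root z) ^+ 4 = z by rewrite rootCK.
have [a0|a0] := eqVneq a 0.
  move: acb aec ced; rewrite a0 !mul0r => /esym/eqP; rewrite expf_eq0 /= => /eqP ->.
  move=> /esym/eqP; rewrite expf_eq0 /= => /eqP ->.
  rewrite mul0r => /esym/eqP; rewrite expf_eq0 /= => /eqP ->.
  by exists 0, (4.-root e); rewrite rK !expr0n /= !mul0r.
set s := 4.-root a; have sa : s ^+ 4 = a by rewrite /s rK.
have s0 : s != 0 by apply: contraNneq a0 => s0; rewrite -sa s0 expr0n.
have Eb : b = s ^+ 3 * (b / s ^+ 3) by field.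
move: (b / s ^+ 3) Eb => t Eb; exists s, t.
have cE : c = s ^+ 2 * t ^+ 2.
  by apply: (mulfI a0); rewrite acb Eb -sa; ring.
have dE : d = s * t ^+ 3.
  by apply: (mulfI a0); rewrite adb cE Eb -sa; ring.
split=> //; apply: (mulfI a0); rewrite aec cE -sa; ring.
Qed.

(** The same argument without [c]: the cubic equations determine [d] when [a != 0], and force [b]
    and [d] to vanish when [a = 0]. *)
Lemma projected_quartic_cone_param (a b d e : C) :
  a * e = b * d -> b ^+ 3 = a ^+ 2 * d -> d ^+ 3 = b * e ^+ 2 ->
  exists s t, [/\ a = s ^+ 4, b = s ^+ 3 * t, d = s * t ^+ 3 & e = t ^+ 4].
Proof.
move=> aebd b3 d3.
have rK (z : C) : (4.-root z) ^+ 4 = z by rewrite rootCK.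
have [a0|a0] := eqVneq a 0.
  move: b3 d3; rewrite a0 expr0n /= mul0r => /eqP; rewrite expf_eq0 /= => /eqP ->.
  rewrite mul0r => /eqP; rewrite expf_eq0 /= => /eqP ->.
  by exists 0, (4.-root e); rewrite rK !expr0n /= !mul0r.
set s := 4.-root a; have sa : s ^+ 4 = a by rewrite /s rK.
have s0 : s != 0 by apply: contraNneq a0 => s0; rewrite -sa s0 expr0n.
have Eb : b = s ^+ 3 * (b / s ^+ 3) by field.
move: (b / s ^+ 3) Eb => t Eb; exists s, t.
have dE : d = s * t ^+ 3.
  by apply: (mulfI (expf_neq0 2 a0)); rewrite -b3 Eb -sa; ring.
split=> //; apply: (mulfI a0); rewrite aebd Eb dE -sa; ring.
Qed.

(** In the factor [3], two units come from [b + b'] and one from [c'], each term being bounded by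
    [normc a]. *)
Lemma normc_sub_middle_of_max (a b c a' b' c' : C) (D : R) :
  a * c = b ^+ 2 -> a' * c' = b' ^+ 2 ->
  normc b <= normc a -> normc b' <= normc a -> normc c' <= normc a ->
  0 < normc a ->
  normc (a - a') <= D -> normc (b - b') <= D -> normc (c - c') <= 3 * D.
Proof.
move=> E E' hb hb' hc' a0 ha hbb.
have D0 : 0 <= D by apply: le_trans ha; apply: normc_ge0.
rewrite -(ler_pM2l a0) -normcM.
have -> : a * (c - c') = (b + b') * (b - b') - c' * (a - a').
  transitivity (a * c - a' * c' - c' * (a - a')); first by ring.
  by rewrite E E'; ring.
apply: le_trans (normc_sub _ _) _; rewrite !normcM.
have -> : normc a * (3 * D) = (normc a + normc a) * D + normc a * D by ring.
apply: lerD; apply: ler_pM; rewrite ?normc_ge0 //.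
by apply: le_trans (le_normcD _ _) _; apply: lerD.
Qed.

Lemma normc_middle_le (a c e : C) m : a * e = c ^+ 2 ->
  normc a <= m -> normc e <= m -> normc c <= m.
Proof.
move=> E am em; have m0 : 0 <= m by apply: le_trans am; apply: normc_ge0.
rewrite -(ler_pXn2r (n := 2)) ?nnegrE ?normc_ge0 //.
by rewrite !expr2 -normcM -expr2 -E normcM ler_pM ?normc_ge0.
Qed.

Lemma normc_sub_middle (a b c d e a' b' c' d' e' : C) (D : R) :
  a * c = b ^+ 2 -> c * e = d ^+ 2 -> a * e = c ^+ 2 ->
  a' * c' = b' ^+ 2 -> c' * e' = d' ^+ 2 -> a' * e' = c' ^+ 2 ->
  normc (a - a') <= D -> normc (b - b') <= D ->
  normc (d - d') <= D -> normc (e - e') <= D -> normc (c - c') <= 3 * D.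
Proof.
move=> E1 E2 E3 E1' E2' E3' Da Db Dd De.
have swap (z w : C) : normc (z - w) = normc (w - z) by rewrite -opprB normcN.
pose m := Num.max (Num.max (normc a) (normc e)) (Num.max (normc a') (normc e')).
have [am em a'm e'm] : [/\ normc a <= m, normc e <= m, normc a' <= m & normc e' <= m].
  by rewrite /m !le_max !lexx !orbT.
have cm := normc_middle_le E3 am em; have c'm := normc_middle_le E3' a'm e'm.
have bm := normc_middle_le E1 am cm; have b'm := normc_middle_le E1' a'm c'm.
have dm := normc_middle_le E2 cm em; have d'm := normc_middle_le E2' c'm e'm.
(* If the maximum is zero, division by it is impossible, but then [c] and [c'] are both zero. *)
have [m0|m0] := leP m 0.
  have z (w : C) : normc w <= m -> w = 0.
    move=> wm; apply/eq0_normc/le_anti.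
    by rewrite normc_ge0 (le_trans wm).
  rewrite (z c cm) (z c' c'm) subr0 normc0 mulr_ge0 //.
  by apply: le_trans Da; apply: normc_ge0.
have : [|| m == normc a, m == normc e, m == normc a' | m == normc e'].
  by rewrite /m /Num.max; repeat case: ifP => _; rewrite eqxx ?orbT.
(* The four cases differ by exchanging the two points and by reversing the order of
   [a, b, c, d, e]. *)
case/or4P => /eqP Em; rewrite Em in m0 am em a'm e'm bm b'm cm c'm dm d'm.
- exact: (normc_sub_middle_of_max E1 E1').
- by apply: (@normc_sub_middle_of_max e d c e' d' c') => //; rewrite mulrC.
- by rewrite swap; apply: (normc_sub_middle_of_max E1' E1) => //; rewrite swap.
- by rewrite swap; apply: (@normc_sub_middle_of_max e' d' c' e d c) => //;
    rewrite ?[_ * c]mulrC ?[_ * c']mulrC // swap.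
Qed.

End QuarticCurve.

Section QuarticCone.
Variables (R : realType) (k : nat).
Local Notation C := R[i].
Local Notation r := k.+2.
Local Notation n := k.+4.+1.

(* Exponent of the [l]-th variable in the [i]-th coordinate of
   [(s, t, u) |-> (s^4, s^3 t, s^2 t^2, s t^3, t^4, u)]; the truncated
   subtraction vanishes for [i > 4]. *)
Definition quartic_exponent (i l : nat) : nat :=
  match l with
  | 0 => 4 - i
  | 1 => if (i <= 4)%N then i else 0
  | l'.+2 => (i == l'.+4.+1)
  end.

Definition quartic_mnm (i : nat) : 'X_{1..r} :=
  [multinom quartic_exponent i l | l < r].

Definition quartic_cone : n.-tuple {mpoly C[r]} :=
  [tuple 'X_[quartic_mnm i] | i < n].

Definition projected_quartic_cone : n.-tuple {mpoly C[r]} :=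
  [tuple if i == 2%N :> nat then 0 else 'X_[quartic_mnm i] | i < n].

Definition degree_mod4 : pred 'X_{1..r} :=
  fun m => (4 %| m ord0 + m (lift ord0 ord0))%N.

Definition no_middle : pred 'X_{1..r} :=
  fun m => degree_mod4 m && ~~ ((m ord0 == 2%N) && (m (lift ord0 ord0) == 2%N)).

Lemma degree_mod40 : degree_mod4 0%MM.
Proof. by rewrite /degree_mod4 !mnmE. Qed.

Lemma degree_mod4D m1 m2 : degree_mod4 m1 -> degree_mod4 m2 -> degree_mod4 (m1 + m2)%MM.
Proof. by rewrite /degree_mod4 !mnmE addnACA; apply: dvdn_add. Qed.

Lemma degree_mod4_cancel m1 m2 :
  degree_mod4 m1 -> degree_mod4 (m1 + m2)%MM -> degree_mod4 m2.
Proof. by rewrite /degree_mod4 !mnmE addnACA => h; rewrite dvdn_addr. Qed.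

Lemma no_middle0 : no_middle 0%MM.
Proof. by rewrite /no_middle degree_mod40 !mnmE. Qed.

(** If a sum has exponents [(2, 2)] in [s, t], divisibility by [4] forces one summand to have total
    degree [4] there and the other [0]; the former is then already [(2, 2)]. *)
Lemma no_middleD m1 m2 : no_middle m1 -> no_middle m2 -> no_middle (m1 + m2)%MM.
Proof.
move=> /andP[d1 n1] /andP[d2 n2]; rewrite /no_middle degree_mod4D //=.
move: d1 n1 d2 n2; rewrite /degree_mod4 !mnmE.
move: (m1 _) (m1 _) (m2 _) (m2 _) => a b c d; lia.
Qed.

Lemma quartic_mnm_degree_mod4 i : degree_mod4 (quartic_mnm i).
Proof.
rewrite /degree_mod4 !mnmE /=; case: ifP => [i4|]; first by rewrite subnK.
by rewrite addn0; move: i => [|[|[|[|[|i]]]]].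
Qed.

Lemma quartic_mnm_no_middle i : i != 2%N -> no_middle (quartic_mnm i).
Proof.
move=> i2; rewrite /no_middle quartic_mnm_degree_mod4 !mnmE /=.
by move: i i2 => [|[|[|[|[|i]]]]].
Qed.

Lemma quartic_mnm_middle : ~~ no_middle (quartic_mnm 2).
Proof. by rewrite /no_middle !mnmE andbF. Qed.

Lemma quartic_coordinate (v : 'I_r -> C) (i : nat) :
  ('X_[quartic_mnm i] : {mpoly C[r]}).@[v] =
  v ord0 ^+ (4 - i) * v (lift ord0 ord0) ^+ (if (i <= 4)%N then i else 0) *
  \prod_(l < k) v (lift ord0 (lift ord0 l)) ^+ (i == l.+4.+1).
Proof.
rewrite mevalX !big_ord_recl mulrA !mnmE /=; congr (_ * _).
by apply: eq_bigr => l _; rewrite mnmE.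
Qed.

Lemma quartic_coordinate_small (v : 'I_r -> C) (i : nat) : (i <= 4)%N ->
  ('X_[quartic_mnm i] : {mpoly C[r]}).@[v] =
  v ord0 ^+ (4 - i) * v (lift ord0 ord0) ^+ i.
Proof.
move=> i4; rewrite quartic_coordinate i4 big1 ?mulr1 // => l _.
by rewrite ltn_eqF // (leq_ltn_trans i4).
Qed.

Lemma quartic_coordinate_large (v : 'I_r -> C) (l : 'I_k) :
  ('X_[quartic_mnm l.+4.+1] : {mpoly C[r]}).@[v] = v (lift ord0 (lift ord0 l)).
Proof.
rewrite quartic_coordinate /= !expr0 !mul1r (bigD1 l) //= eqxx expr1.
rewrite big1 ?mulr1 // => j jl; rewrite !eqSS.
by rewrite [(l : nat) == j]eq_sym (negbTE (jl : (j : nat) != l)).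
Qed.

(** The free parameters are read off from [y]: they start at index [2] among the parameters and at
    index [5] among the coordinates. *)
Definition point (s t : C) (y : 'rV[C]_n) (l : 'I_r) : C :=
  match val l with
  | 0 => s
  | 1 => t
  | l'.+2 => y 0 (inord l'.+4.+1)
  end.

Definition entry (y : 'rV[C]_n) (i : nat) : C := y 0 (inord i).

Lemma quartic_conePl (v : 'I_r -> C) i : (i <= 4)%N ->
  entry (\row_j (tnth quartic_cone j).@[v]) i =
  v ord0 ^+ (4 - i) * v (lift ord0 ord0) ^+ i.
Proof.
move=> i4; rewrite /entry mxE tnth_mktuple inordK; last by lia.
exact: quartic_coordinate_small.
Qed.

Lemma projected_quartic_conePl (v : 'I_r -> C) i : (i <= 4)%N ->
  entry (\row_j (tnth projected_quartic_cone j).@[v]) i =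
  if i == 2%N then 0 else v ord0 ^+ (4 - i) * v (lift ord0 ord0) ^+ i.
Proof.
move=> i4; rewrite /entry mxE tnth_mktuple inordK; last by lia.
by case: ifP => _; rewrite ?meval0 ?quartic_coordinate_small.
Qed.

Lemma quartic_point s t (y : 'rV[C]_n) (i : 'I_n) :
  ('X_[quartic_mnm i] : {mpoly C[r]}).@[point s t y] =
  if (i <= 4)%N then s ^+ (4 - i) * t ^+ i else y 0 i.
Proof.
case: ifP => [i4|]; first by rewrite quartic_coordinate_small.
move/negbT; rewrite -ltnNge => i4.
have il : (i - 5 < k)%N by have := ltn_ord i; lia.
have Ei : i = (Ordinal il).+4.+1 :> nat by rewrite /=; lia.
rewrite {1}Ei quartic_coordinate_large /point /=; congr (y 0 _).
by apply/ord_inj; rewrite inordK /bump /=; lia.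
Qed.

Lemma quartic_coordinate0 (i : 'I_n) :
  ('X_[quartic_mnm i] : {mpoly C[r]}).@[fun=> 0] = 0.
Proof.
transitivity (('X_[quartic_mnm i] : {mpoly C[r]}).@[point 0 0 0]).
  by apply: meval_eq => l; rewrite /point; case: (val l) => [|[|l']]; rewrite ?mxE.
rewrite quartic_point; case: ifP => [i4|]; last by rewrite mxE.
by rewrite -exprD subnK // expr0n.
Qed.

Lemma quartic_conePr (y : 'rV[C]_n) s t :
  (forall i, (i <= 4)%N -> entry y i = s ^+ (4 - i) * t ^+ i) ->
  poly_image quartic_cone y.
Proof.
move=> h; exists (point s t y); apply/rowP => i; rewrite mxE tnth_mktuple quartic_point.
by case: ifP => // i4; rewrite -h // /entry inord_val.
Qed.

Lemma projected_quartic_conePr (y : 'rV[C]_n) s t : entry y 2 = 0 ->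
  (forall i, (i <= 4)%N -> i != 2%N -> entry y i = s ^+ (4 - i) * t ^+ i) ->
  poly_image projected_quartic_cone y.
Proof.
move=> y2 h; exists (point s t y); apply/rowP => i; rewrite mxE tnth_mktuple.
have [i2|i2] := eqVneq (i : nat) 2%N; first by rewrite meval0 -y2 /entry -i2 inord_val.
by rewrite quartic_point; case: ifP => // i4; rewrite -h // /entry inord_val.
Qed.

Lemma quartic_cone_equations (y : 'rV[C]_n) : poly_image quartic_cone y ->
  [/\ entry y 0 * entry y 2 = entry y 1 ^+ 2, entry y 2 * entry y 4 = entry y 3 ^+ 2,
      entry y 0 * entry y 4 = entry y 2 ^+ 2 & entry y 0 * entry y 3 = entry y 1 * entry y 2].
Proof.
by move=> [v ->]; rewrite !quartic_conePl //=; split; ring.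
Qed.

Lemma entry_meval (y : 'rV[C]_n) i : entry y i = ('X_(inord i) : {mpoly C[n]}).@[y 0].
Proof. by rewrite mevalXU. Qed.

(** Carries the equations of the cones from their points to any [y] in the Zariski closure. *)
Lemma algebraic_eq (X : set 'rV[C]_n) (p q : {mpoly C[n]}) (y : 'rV[C]_n) :
  (forall p, vanishing_on X p -> p.@[y 0] = 0) ->
  (forall z : 'rV[C]_n, X z -> p.@[z 0] = q.@[z 0]) -> p.@[y 0] = q.@[y 0].
Proof.
move=> h pq; apply/eqP; rewrite -subr_eq0 -mevalB; apply/eqP/h => z Xz.
by rewrite mevalB (pq z Xz) subrr.
Qed.

Lemma algebraic_quartic_cone : algebraic_set (poly_image quartic_cone).
Proof.
apply/algebraic_setP => y h.
pose x i : {mpoly C[n]} := 'X_(inord i).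
have xE i (z : 'rV[C]_n) : (x i).@[z 0] = entry z i by rewrite entry_meval.
have [E1 E2 E3 E4] : [/\ entry y 0 * entry y 2 = entry y 1 ^+ 2,
    entry y 2 * entry y 4 = entry y 3 ^+ 2, entry y 0 * entry y 4 = entry y 2 ^+ 2
    & entry y 0 * entry y 3 = entry y 1 * entry y 2].
  split; rewrite -!xE -?mevalXn -!mevalM; apply: (algebraic_eq h) => z Xz;
    rewrite !mevalM ?mevalXn !xE; by case: (quartic_cone_equations Xz).
have [s [t [Ea Eb Ec Ed Ee]]] := quartic_cone_param E1 E2 E3 E4.
apply: (@quartic_conePr y s t) => -[|[|[|[|[|]]]]] //= _;
  by rewrite ?expr0 ?expr1 ?mulr1 ?mul1r.
Qed.

Lemma algebraic_projected_quartic_cone :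
  algebraic_set (poly_image projected_quartic_cone).
Proof.
apply/algebraic_setP => y h.
pose x i : {mpoly C[n]} := 'X_(inord i).
have xE i (z : 'rV[C]_n) : (x i).@[z 0] = entry z i by rewrite entry_meval.
have [E0 E1 E2 E3] : [/\ entry y 2 = 0, entry y 0 * entry y 4 = entry y 1 * entry y 3,
    entry y 1 ^+ 3 = entry y 0 ^+ 2 * entry y 3
    & entry y 3 ^+ 3 = entry y 1 * entry y 4 ^+ 2].
  split; last first.
  1-3: rewrite -!xE -?mevalXn -!mevalM; apply: (algebraic_eq h) => z [v ->];
    rewrite !mevalM ?mevalXn !xE !projected_quartic_conePl //=; ring.
  rewrite -xE; apply: h => z [v ->].
  by rewrite xE projected_quartic_conePl.
have [s [t [Ea Eb Ed Ee]]] := projected_quartic_cone_param E1 E2 E3.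
apply: (@projected_quartic_conePr y s t) => // -[|[|[|[|[|]]]]] //= _ _;
  by rewrite ?expr0 ?expr1 ?mulr1 ?mul1r.
Qed.

End QuarticCone.

Lemma mcoeff0_meval (K : fieldType) n (p : {mpoly K[n]}) : p.@[fun=> 0] = p@_0%MM.
Proof.
rewrite mevalE [in RHS](mpolyE p) raddf_sum; apply: eq_bigr => m _.
rewrite /= mcoeffZ mcoeffX; congr (_ * _).
have [->|m0] := eqVneq m 0%MM.
  by rewrite big1 // => i _; rewrite mnmE expr0.
have [i mi] : exists i, m i != 0%N.
  apply/existsP; apply: contraNT m0; rewrite negb_exists => /forallP h.
  by apply/eqP/mnmP => i; rewrite mnmE; apply/eqP; have := h i; rewrite negbK.
by rewrite (bigD1 i) //= expr0n (negbTE mi) mul0r.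
Qed.

(** The graph is cut out by the equations of [X] in the first block of variables and by the
    differences between the second block and [F]. *)
Lemma algebraic_graph (R : realType) n m (X : set 'rV[R[i]]_n) (f : 'rV_n -> 'rV_m)
    (F : m.-tuple {mpoly R[i][n]}) :
  (forall x, f x = \row_i (tnth F i).@[x 0]) ->
  algebraic_set X -> algebraic_set [set row_mx x (f x) | x in X].
Proof.
move=> fF /algebraic_setP algX; apply/algebraic_setP => y h.
pose fst_vars : n.-tuple {mpoly R[i][n + m]} := [tuple 'X_(lshift m i) | i < n].
have fstE p (z : 'rV[R[i]]_(n + m)) : (p \mPo fst_vars).@[z 0] = p.@[(lsubmx z) 0].
  by rewrite comp_mpoly_meval; apply: meval_eq => i; rewrite tnth_mktuple mevalXU mxE.
exists (lsubmx y).
  apply: algX => p pX; rewrite -fstE; apply: h => z [x Xx <-].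
  by rewrite fstE row_mxKl; apply: pX.
rewrite -[RHS]hsubmxK; congr row_mx; apply/rowP => i; rewrite fF !mxE.
apply/eqP; rewrite -fstE -(mevalXU (y 0) (rshift n i)) -subr_eq0 -mevalB; apply/eqP.
apply: h => z [x Xx <-].
by rewrite mevalB fstE row_mxKl mevalXU row_mxEr fF mxE subrr.
Qed.

(** * Normality, dimension and the projection forgetting the middle coordinate *)

Section Projection.
Variables (R : realType) (k : nat).
Local Notation C := R[i].
Local Notation r := k.+2.
Local Notation n := k.+4.+1.
Local Notation X := (poly_image (quartic_cone R k)).
Local Notation Y := (poly_image (projected_quartic_cone R k)).

(** Whole fourth powers of [s] and [t] go to coordinates [0] and [4]. When the total degree in
    [s, t] is divisible by [4], what is left is [1] or one of [s^3 t], [s^2 t^2], [s t^3], selected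
    by the residue of the exponent of [s]. *)
Definition quartic_lift_exponent (m : 'X_{1..r}) (i : nat) : nat :=
  match i with
  | 0 => m ord0 %/ 4
  | 4 => m (lift ord0 ord0) %/ 4
  | i'.+4.+1 => m (inord i'.+2)
  | _ => (m ord0 %% 4 == 4 - i)%N
  end%N.

Definition quartic_lift (m : 'X_{1..r}) : 'X_{1..n} :=
  [multinom quartic_lift_exponent m i | i < n].

Lemma sum_split5 (F : nat -> nat) :
  (\sum_(i < n) F i = F 0 + F 1 + F 2 + F 3 + F 4 + \sum_(i < k) F i.+4.+1)%N.
Proof.
rewrite -(big_mkord xpredT F) -(big_mkord xpredT (fun i => F i.+4.+1)).
by do 5! rewrite big_nat_recl //; rewrite !addnA.
Qed.

Lemma quartic_liftE m : degree_mod4 m ->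
  'X_[quartic_lift m] \mPo quartic_cone R k = 'X_[m].
Proof.
move=> m4; rewrite comp_mpolyX.
transitivity ('X_[(\sum_(i < n) quartic_mnm k i *+ quartic_lift m i)%MM] : {mpoly C[r]}).
  rewrite -mprodXE; apply: eq_bigr => i _.
  by rewrite tnth_mktuple mpolyXn.
congr 'X_[_]; apply/mnmP => l; rewrite mnm_sumE.
under eq_bigr => i _ do rewrite mulmnE !mnmE.
rewrite (sum_split5 (fun i => quartic_exponent i l * quartic_lift_exponent m i)%N).
have [l0|[l1|[l' El]]] : l = ord0 \/ l = lift ord0 ord0 \/
    exists l' : 'I_k, l = lift ord0 (lift ord0 l').
- case: (unliftP ord0 l) => [j ->|->]; last by left.
  by right; case: (unliftP ord0 j) => [l' ->|->]; [right; exists l'|left].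
- rewrite l0 [X in (_ + X)%N]big1 //= addn0 mul0n addn0.
  move: (m ord0) => a; have := divn_eq a 4; have := @ltn_pmod a 4 isT.
  by move: (a %% 4)%N => [|[|[|[|]]]] //= _; lia.
- rewrite l1 [X in (_ + X)%N]big1 //= addn0.
  move: m4; rewrite /degree_mod4; move: (m ord0) (m (lift ord0 ord0)) => a b.
  rewrite -[(a + b)%N]/(addn a b) /dvdn -modnDm.
  have := divn_eq b 4; have := @ltn_pmod a 4 isT; have := @ltn_pmod b 4 isT.
  by move: (a %% 4)%N (b %% 4)%N => [|[|[|[|]]]] // [|[|[|[|]]]] //= _ _; lia.
- rewrite El /= !mul0n !add0n (bigD1 l') //= !eqxx mul1n big1 ?addn0.
    by congr (m _); apply/ord_inj; rewrite inordK // !ltnS ltn_ord.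
  move=> j jl; rewrite !eqSS.
  have -> : (j == l' :> nat) = false by exact: negbTE.
  by rewrite mul0n.
Qed.

Lemma normal_quartic_cone : normal_variety X.
Proof.
apply: normal_poly_image => g f w g0 E.
have gen i : supported (@degree_mod4 k) (tnth (quartic_cone R k) i).
  by rewrite tnth_mktuple; apply/supportedX/quartic_mnm_degree_mod4.
have comp p : supported (@degree_mod4 k) (p \mPo quartic_cone R k).
  by apply: supported_comp gen; [apply: degree_mod40|apply: degree_mod4D].
have wS : supported (@degree_mod4 k) w.
  apply: (supported_quotient (@degree_mod4D k) (@degree_mod4_cancel k) g0).
    exact: comp.
  by rewrite E; apply: comp.
(* As every monomial of [w] has degree divisible by [4] in [s, t], it can be lifted separately. *)
exists (\sum_(m <- msupp w) w@_m *: 'X_[quartic_lift m]).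
rewrite comp_mpoly_sum [LHS]mpolyE; apply: eq_big_seq => m /wS m4.
by rewrite comp_mpolyZ quartic_liftE.
Qed.

Lemma quartic_dimension : has_dimension X r.
Proof.
(* The selected coordinates are [s^4], [t^4] and the free ones; each vanishes exactly when its
   parameter does. *)
pose theta (i : 'I_r) : 'I_n :=
  inord (match val i with 0 => 0 | 1 => 4 | l.+2 => l.+4.+1 end)%N.
apply: (@has_dimension_poly_image R r n (quartic_cone R k) theta).
  exact: algebraic_quartic_cone.
have pow4 (z : C) : z ^+ 4 = 0 <-> z = 0.
  by split=> [/eqP|->]; [rewrite expf_eq0 => /eqP|rewrite expr0n].
move=> v i; rewrite tnth_mktuple /theta.
case: (unliftP ord0 i) => [j ->|->]; last first.
  by rewrite inordK //= quartic_coordinate_small // mulr1.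
case: j => [[|l] hl]; rewrite /= inordK //=.
  rewrite quartic_coordinate_small //= mul1r.
  have -> : lift ord0 (Ordinal hl) = lift ord0 ord0 by apply/val_inj.
  exact: pow4.
have hl' : (l < k)%N by [].
rewrite (quartic_coordinate_large v (Ordinal hl')).
by have -> : lift ord0 (lift ord0 (Ordinal hl')) = lift ord0 (Ordinal hl) by apply/val_inj.
Qed.

Lemma not_normal_projected_quartic_cone : ~ normal_variety Y.
Proof.
move=> nY; pose psi := projected_quartic_cone R k.
have tnthE i : (i <= 4)%N -> i != 2%N -> 'X_(inord i) \mPo psi = 'X_[quartic_mnm k i].
  move=> i4 i2; rewrite comp_mpolyXU -tnth_nth tnth_mktuple inordK ?(negbTE i2) //.
  by rewrite ltnS (leq_trans i4).
have Y0 : Y 0.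
  apply: (@projected_quartic_conePr _ _ _ 0 0); rewrite /entry ?mxE //.
  by move=> [|[|[|[|[|]]]]] //= _ _; rewrite mxE ?expr0n ?mulr0 ?mul0r.
pose x i : {mpoly C[n]} := 'X_(inord i).
(* The fraction [x 1 ^+ 2 / x 0] pulls back to [s^2 t^2], whose square is the pullback of
   [x 0 * x 4]. Normality at the origin would make it [w / g]. *)
have [||g [w [g0 E]]] := @normal_image_sqrt _ _ _ psi 0 (x 1%N ^+ 2) (x 0%N) (x 0%N * x 4%N) nY Y0.
- by rewrite (tnthE 0%N isT isT) -msupp_eq0 msuppX.
- rewrite comp_mpolyXn [(_ * x 4%N) \mPo _]comp_mpolyM.
  rewrite (tnthE 0%N isT isT) (tnthE 1%N isT isT) (tnthE 4%N isT isT) !mpolyXn -!mpolyXD.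
  congr 'X_[_]; apply/mnmP => l; rewrite !(mnmDE, mulmnE, mnmE).
  by case: l => -[|[|l]] hl.
have square : (x 1%N ^+ 2) \mPo psi = 'X_[quartic_mnm k 0] * 'X_[quartic_mnm k 2].
  rewrite comp_mpolyXn (tnthE 1%N isT isT) mpolyXn -mpolyXD.
  congr 'X_[_]; apply/mnmP => l; rewrite !(mnmDE, mulmnE, mnmE).
  by case: l => -[|[|l]] hl.
have EW : (g \mPo psi) * 'X_[quartic_mnm k 2] = w \mPo psi.
  apply: (mulfI (x := 'X_[quartic_mnm k 0])); first by rewrite -msupp_eq0 msuppX.
  by move: E; rewrite square (tnthE 0%N isT isT) => <-; rewrite mulrCA.
have : (w \mPo psi)@_(quartic_mnm k 2) = 0.
  apply: (@supported_coeff _ _ (@no_middle k)).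
    apply: supported_comp => [||i]; [exact: no_middle0|exact: no_middleD|].
    rewrite tnth_mktuple; case: eqVneq => [_|i2]; first exact: supported0.
    exact/supportedX/quartic_mnm_no_middle.
  exact: quartic_mnm_middle.
(* The coefficient of [s^2 t^2] in its product with [g \mPo psi] is the constant term of the latter,
   that is, the value of [g] at the origin. *)
rewrite -EW -[X in _@_X]addm0 mcoeffMX -mcoeff0_meval comp_mpoly_meval => G0.
case/eqP: g0; rewrite -[RHS]G0; apply: meval_eq => i.
rewrite mxE tnth_mktuple; case: ifP => _; first by rewrite meval0.
by rewrite quartic_coordinate0.
Qed.

Definition drop_middle (x : 'rV[C]_n) : 'rV[C]_n :=
  \row_i (if i == 2%N :> nat then 0 else x 0 i).

Lemma drop_middle_cone (v : 'I_r -> C) :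
  drop_middle (\row_i (tnth (quartic_cone R k) i).@[v]) =
  \row_i (tnth (projected_quartic_cone R k) i).@[v].
Proof.
apply/rowP => i; rewrite !mxE !tnth_mktuple.
by case: ifP; rewrite ?meval0.
Qed.

Lemma drop_middle_set_fun : set_fun X Y drop_middle.
Proof. by move=> _ [v ->]; exists v; rewrite drop_middle_cone. Qed.

Lemma drop_middle_surj y : Y y -> exists x, X x /\ drop_middle x = y.
Proof.
move=> [v ->]; exists (\row_i (tnth (quartic_cone R k) i).@[v]).
by split; [exists v|apply: drop_middle_cone].
Qed.

Lemma drop_middle_entry (x x' : 'rV[C]_n) i : (i <= 4)%N -> i != 2%N ->
  normc (entry x i - entry x' i) <= euclidean_norm (drop_middle x - drop_middle x').
Proof.
move=> i4 i2; apply: le_trans (normc_le_euclidean_norm _ (inord i)).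
by rewrite !mxE inordK ?(negbTE i2) // ltnS (leq_trans i4).
Qed.

Lemma euclidean_norm_drop_middle (x x' : 'rV[C]_n) :
  euclidean_norm (x - x') ^+ 2 = normc (entry x 2 - entry x' 2) ^+ 2 +
    euclidean_norm (drop_middle x - drop_middle x') ^+ 2.
Proof.
rewrite !sqr_euclidean_norm (bigD1 (inord 2)) //= [in RHS](bigD1 (inord 2)) //=.
rewrite !mxE !inordK // eqxx subrr normc0 expr0n add0r; congr (_ + _).
apply: eq_bigr => i i2; rewrite !mxE.
have [E|//] := eqVneq (i : nat) 2%N.
by case/eqP: i2; apply/ord_inj; rewrite inordK.
Qed.

Lemma drop_middle_le (x x' : 'rV[C]_n) :
  euclidean_norm (drop_middle x - drop_middle x') <= euclidean_norm (x - x').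
Proof.
rewrite -(ler_pXn2r (n := 2)) ?nnegrE ?euclidean_norm_ge0 //.
by rewrite (euclidean_norm_drop_middle x x') lerDr sqr_ge0.
Qed.

(** By Pythagoras the squared distance is at most [(3 * D) ^+ 2 + D ^+ 2 = 10 * D ^+ 2], below
    [(4 * D) ^+ 2]. *)
Lemma drop_middle_ge (x x' : 'rV[C]_n) : X x -> X x' ->
  euclidean_norm (x - x') <= 4 * euclidean_norm (drop_middle x - drop_middle x').
Proof.
move=> /quartic_cone_equations[E1 E2 E3 _] /quartic_cone_equations[E1' E2' E3' _].
set D := euclidean_norm (drop_middle x - _).
have D0 : 0 <= D by apply: euclidean_norm_ge0.
have c3 : normc (entry x 2 - entry x' 2) <= 3 * D.
  by apply: (normc_sub_middle E1 E2 E3 E1' E2' E3'); apply: drop_middle_entry.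
rewrite -(ler_pXn2r (n := 2)) ?nnegrE ?euclidean_norm_ge0 ?mulr_ge0 //.
rewrite (euclidean_norm_drop_middle x x') -/D.
have : normc (entry x 2 - entry x' 2) ^+ 2 <= (3 * D) ^+ 2.
  by rewrite ler_pXn2r ?nnegrE ?normc_ge0 ?mulr_ge0.
rewrite !exprMn -!natrX; have := sqr_ge0 D.
by move: (normc _ ^+ 2) (D ^+ 2) => z w; lra.
Qed.

Lemma drop_middle_inj (x x' : 'rV[C]_n) : X x -> X x' ->
  drop_middle x = drop_middle x' -> x = x'.
Proof.
move=> Xx Xx' E; have := drop_middle_ge Xx Xx'; rewrite E subrr.
have -> : euclidean_norm (0 : 'rV[C]_n) = 0.
  by rewrite /euclidean_norm big1 ?sqrtr0 // => i _; rewrite mxE normc0 expr0n.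
rewrite mulr0 => le0; apply/rowP => i; apply/eqP; rewrite -subr_eq0; apply/eqP.
have := le_trans (normc_le_euclidean_norm (x - x') i) le0.
rewrite !mxE => h; apply/eq0_normc/le_anti.
by rewrite h normc_ge0.
Qed.

Lemma drop_middle_homeomorphism : homeomorphism X Y drop_middle.
Proof.
split; first exact: drop_middle_set_fun.
  apply: (@lipschitz_continuous_on _ _ _ _ _ 1) => // x x' _ _.
  by rewrite mul1r drop_middle_le.
(* The inverse is a chosen preimage, with the irrelevant value [0] where none exists; the lower
   bound [drop_middle_ge] makes it Lipschitz on [Y]. *)
pose g y : 'rV[C]_n := xget 0 [set x | X x /\ drop_middle x = y].
have gP y : Y y -> X (g y) /\ drop_middle (g y) = y.
  by move=> /drop_middle_surj; apply: xgetPex.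
exists g; split.
- by move=> y /gP[].
- apply: (@lipschitz_continuous_on _ _ _ _ _ 4) => // y y' /gP[Xy Ey] /gP[Xy' Ey'].
  by apply: le_trans (drop_middle_ge Xy Xy') _; rewrite Ey Ey'.
- move=> x Xx; have [Xg Eg] := gP _ (drop_middle_set_fun Xx).
  exact: drop_middle_inj.
- by move=> y /gP[].
Qed.

Lemma drop_middle_bilipschitz : bilipschitz X drop_middle.
Proof.
exists 4 => // x x' Xx Xx'; split.
  by rewrite mulrC ler_pdivrMr // mulrC; apply: drop_middle_ge.
apply: le_trans (drop_middle_le x x') _.
by have := euclidean_norm_ge0 (x - x'); lra.
Qed.

Lemma drop_middle_algebraic : algebraic_map X Y drop_middle.
Proof.
have [? ? _] := drop_middle_homeomorphism; split=> //.
apply: (@algebraic_graph _ _ _ _ _ [tuple if i == 2%N :> nat then 0 else 'X_i | i < n]).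
  move=> x; apply/rowP => i; rewrite !mxE tnth_mktuple.
  by case: ifP; rewrite ?meval0 ?mevalXU.
exact: algebraic_quartic_cone.
Qed.

End Projection.

Theorem theorem5p3 (R : realType) (r : nat) (hr : (1 < r)%N) :
  exists (n m : nat) (X : set 'rV[R[i]]_n) (Y : set 'rV[R[i]]_m)
    (phi : 'rV[R[i]]_n -> 'rV[R[i]]_m),
    [/\ algebraic_set X, normal_variety X & has_dimension X r] /\
    (algebraic_set Y /\ ~ normal_variety Y) /\
    algebraic_bilipschitz_homeomorphism X Y phi.
Proof.
case: r hr => [|[|k]] // _.
exists k.+4.+1, k.+4.+1, (poly_image (quartic_cone R k)),
  (poly_image (projected_quartic_cone R k)), (@drop_middle R k).
split; [split|split; split].
- exact: algebraic_quartic_cone.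
- exact: normal_quartic_cone.
- exact: quartic_dimension.
- exact: algebraic_projected_quartic_cone.
- exact: not_normal_projected_quartic_cone.
- exact: drop_middle_homeomorphism.
- exact: drop_middle_algebraic.
- exact: drop_middle_bilipschitz.
Qed.
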